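(* Let $\widehat{G}$ be a subgroup of $\widehat{\operatorname{PC}^{\bowtie}}$ containing ${\mathfrak S}_{\mathrm{fin}}$ and such that its image $G$ in $\operatorname{PC}^{\bowtie}=\widehat{\operatorname{PC}^{\bowtie}}/{\mathfrak S}_{\mathrm{fin}}$ is a nonabelian simple group. Then $\widehat{G}$ has exactly five normal subgroups, namely $\{1\}$, ${\mathfrak A}_{\mathrm{fin}}$, ${\mathfrak S}_{\mathrm{fin}}$, $\operatorname{Ker}(\varepsilon|_{\widehat G})$ and $\widehat{G}$.
   Context: $X=[0,1[$. $\widehat{\operatorname{PC}^{\bowtie}}$ is the group of bijections $X\to X$ continuous outside a finite subset; ${\mathfrak S}_{\mathrm{fin}}$ is the normal subgroup of finitely supported permutations, $\operatorname{sgn}:{\mathfrak S}_{\mathrm{fin}}\to\mathbb{Z}/2\mathbb{Z}$ the classical signature and ${\mathfrak A}_{\mathrm{fin}}$ its kernel. The homomorphism $\varepsilon:\widehat{\operatorname{PC}^{\bowtie}}\to\mathbb{Z}/2\mathbb{Z}$ is defined as follows. For $h\in\widehat{\operatorname{PC}^{\bowtie}}$, a partition associated with $h$ is a finite partition $\mathcal P=\{I_1,\dots,I_n\}$ of $X$ into intervals $I_j=[\alpha_j,b_j[$ such that $h$ is continuous on the open interval $I_j^\circ=]\alpha_j,b_j[$ for each $j$ (then $h$ is strictly monotone on $I_j^\circ$ and $h(I_j^\circ)$ is an open interval). Let $\beta_j$ be the left endpoint of $h(I_j^\circ)$; the sets $\{h(\alpha_j)\}_j$ and $\{\beta_j\}_j$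 coincide, and $\sigma_{(h,\mathcal P)}\in{\mathfrak S}_{\mathrm{fin}}$ is the permutation sending $h(\alpha_j)$ to $\beta_j$ for every $j$ and fixing all other points. Let $R(h,\mathcal P)$ be the number of $j$ such that $h$ is decreasing on $I_j^\circ$, and $\varepsilon(h,\mathcal P)=R(h,\mathcal P)+\operatorname{sgn}(\sigma_{(h,\mathcal P)})\bmod 2$. There is a unique associated partition $\mathcal P^{\min}_h$ with the fewest intervals (every associated partition refines it), and $\varepsilon(h):=\varepsilon(h,\mathcal P^{\min}_h)$. This $\varepsilon$ is a group homomorphism extending $\operatorname{sgn}$. *)

(* Defs.v *)
From Stdlib Require Import Reals.
From mathcomp Require Import all_boot all_fingroup.

Set Implicit Arguments.
Unset Strict Implicit.
Unset Printing Implicit Defensive.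

Local Open Scope R_scope.

Definition X (x : R) : Prop := 0 <= x < 1.

Definition cont_within_X (h : R -> R) (x : R) : Prop :=
  forall eps, 0 < eps -> exists delta, 0 < delta /\
    forall y, X y -> Rabs (y - x) < delta -> Rabs (h y - h x) < eps.

(** Elements of PC^bowtie-hat: bijections X -> X continuous outside a
    finite subset of X.  A bijection of X is encoded by its extension
    by the identity outside X (this is a bijective encoding). *)
Definition PCB (h : R -> R) : Prop :=
  (forall x, ~ X x -> h x = x) /\
  (forall x, X x -> X (h x)) /\
  (forall x y, X x -> X y -> h x = h y -> x = y) /\
  (forall y, X y -> exists x, X x /\ h x = y) /\
  (exists F : list R, forall x, X x -> ~ List.In x F -> cont_within_X h x).

Definition Sfin (h : R -> R) : Prop :=
  PCB h /\ exists F : list R, forall x, ~ List.In x F -> h x = x.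

(** Classical signature: sgn_rel h b holds iff the finitely supported
    permutation h has signature b (true = odd), computed on any finite
    duplicate-free list L containing the support of h. *)
Definition sgn_rel (h : R -> R) (b : bool) : Prop :=
  exists (L : seq R) (p : {perm 'I_(size L)}),
    List.NoDup L /\
    (forall x, ~ List.In x L -> h x = x) /\
    (forall i : 'I_(size L), h (nth 0 L i) = nth 0 L (p i)) /\
    odd_perm p = b.

Definition Afin (h : R -> R) : Prop := Sfin h /\ sgn_rel h false.

Definition triv (h : R -> R) : Prop := forall x, h x = x.

(** A partition {I_1,...,I_n} of X into intervals I_j = [a_j, b_j[ is
    encoded by the increasing list a = [a_1; ...; a_n] of left endpoints
    (a_1 = 0, b_j = a_(j+1), b_n = 1).  Left endpoint a_j = nth 0 a j,
    right endpoint b_j = nth 1 a j.+1 . *)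
Definition lft (a : seq R) (j : nat) : R := nth 0 a j.
Definition rgt (a : seq R) (j : nat) : R := nth 1 a j.+1.

Definition is_partition (a : seq R) : Prop :=
  (0 < size a)%N /\ lft a 0 = 0 /\
  (forall j : 'I_(size a), X (lft a j)) /\
  (forall i j : 'I_(size a), (i < j)%N -> lft a i < lft a j).

Definition assoc_partition (h : R -> R) (a : seq R) : Prop :=
  is_partition a /\
  forall (j : 'I_(size a)) x, lft a j < x < rgt a j -> continuity_pt h x.

Definition is_inf (S : R -> Prop) (b : R) : Prop :=
  (forall y, S y -> b <= y) /\
  (forall b', (forall y, S y -> b' <= y) -> b' <= b).

(** eps_part h a e : epsilon(h, P) = e, where P is encoded by a.
    d j says whether h is decreasing on I_j° (otherwise increasing);
    beta j is the left endpoint of h(I_j°); the permutation sigma sends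
    h(a_j) to beta_j, i.e. sigma(h(a_j)) = h(a_(p j)); its signature is
    odd_perm p (sigma is conjugate to p via j |-> h(a_j)). *)
Definition eps_part (h : R -> R) (a : seq R) (e : bool) : Prop :=
  exists (d : 'I_(size a) -> bool) (beta : 'I_(size a) -> R)
         (p : {perm 'I_(size a)}),
    (forall j : 'I_(size a), d j -> forall x y,
        lft a j < x -> x < y -> y < rgt a j -> h y < h x) /\
    (forall j : 'I_(size a), ~~ d j -> forall x y,
        lft a j < x -> x < y -> y < rgt a j -> h x < h y) /\
    (forall j : 'I_(size a),
        is_inf (fun y => exists x, lft a j < x < rgt a j /\ h x = y) (beta j)) /\
    (forall j : 'I_(size a), h (lft a (p j)) = beta j) /\
    e = odd (#|[pred j | d j]| + odd_perm p).

Definition eps_val (h : R -> R) (e : bool) : Prop :=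
  exists a, assoc_partition h a /\
    (forall a', assoc_partition h a' -> (size a <= size a')%N) /\
    eps_part h a e.

Definition subgroup (H : (R -> R) -> Prop) : Prop :=
  (forall h, H h -> PCB h) /\
  H id /\
  (forall g h, H g -> H h -> H (fun x => g (h x))) /\
  (forall g, H g -> exists g', H g' /\
      (forall x, g (g' x) = x) /\ (forall x, g' (g x) = x)).

Definition normalPC (N G : (R -> R) -> Prop) : Prop :=
  subgroup N /\ (forall n, N n -> G n) /\
  (forall g g' n, G g -> (forall x, g (g' x) = x) -> (forall x, g' (g x) = x) ->
     N n -> N (fun x => g (n (g' x)))).

Definition same_set (A B : (R -> R) -> Prop) : Prop := forall h, A h <-> B h.

Definition KerEps (G : (R -> R) -> Prop) (h : R -> R) : Prop :=
  G h /\ eps_val h false.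

(** The image of G in PC^bowtie = PC^bowtie-hat / S_fin is a nonabelian
    simple group (G containing S_fin).  Stated via the correspondence
    between subgroups of G/S_fin and subgroups of G containing S_fin:
    - nonabelian: some aS_fin, bS_fin do not commute, i.e. ab is not in
      ba S_fin;
    - simple (nontriviality follows from nonabelian): every normal
      subgroup of G containing S_fin is S_fin or G. *)
Definition quotient_nonabelian_simple (G : (R -> R) -> Prop) : Prop :=
  (exists a b, G a /\ G b /\
     ~ (exists s, Sfin s /\ forall x, a (b x) = b (a (s x)))) /\
  (forall N, normalPC N G -> (forall s, Sfin s -> N s) ->
     same_set N Sfin \/ same_set N G).

(* Main.v *)
Require Import Defs.
From Stdlib Require Import Reals Ranalysis5 Lra.
From mathcomp Require Import all_boot all_fingroup boolp Rstruct.
Set Implicit Arguments.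
Unset Strict Implicit.
Unset Printing Implicit Defensive.

(** [epsilon] is computed from any division [S] of [X] fine enough for [h]: if [b] sends
    each point of [S] to the left endpoint of the image of its interval and agrees with [h]
    elsewhere, it is the parity of [b o h^-1] plus the number of decreasing intervals.  Adding
    a point to [S] does not change this value, so two divisions can be compared on their
    union, and divisions of [h] and [g] can be matched to show that [epsilon] is a
    homomorphism.

    A nontrivial normal subgroup [N] of [G] contains a three-cycle, obtained from commutators
    with transpositions, hence contains [Afin].  If [N] is not inside [Sfin], simplicity gives
    [G = N Sfin]; then [N] is [G] or has index two.  In the second case the elements on which
    the characters of kernels [N] and [Ker epsilon] agree form a normal subgroup containing
    [Sfin] and all commutators, so it is [G] and [N = Ker epsilon]. *)

Local Open Scope R_scope.

(** * Parity of products of transpositions *)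

(** Transpositions are plain functions because they act on the infinite set of reals. In [sws] the
    last pair of the list acts first. *)
Definition sw (T : eqType) (a b x : T) : T :=
  if x == a then b else if x == b then a else x.

Definition sws (T : eqType) (ts : seq (T * T)) (x : T) : T :=
  foldr (fun t y => sw t.1 t.2 y) x ts.

Definition proper_swaps (T : eqType) (ts : seq (T * T)) : bool :=
  all (fun t => t.1 != t.2) ts.

Lemma swL (T : eqType) (a b : T) : sw a b a = b.
Proof. by rewrite /sw eqxx. Qed.

Lemma swR (T : eqType) (a b : T) : sw a b b = a.
Proof. by rewrite /sw eqxx; case: eqP. Qed.

Lemma swD (T : eqType) (a b x : T) : x <> a -> x <> b -> sw a b x = x.
Proof. by rewrite /sw => /eqP/negPf-> /eqP/negPf->. Qed.

Lemma swP (T : eqType) (a b x : T) :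
  [\/ x = a /\ sw a b x = b, x = b /\ sw a b x = a |
      [/\ x <> a, x <> b & sw a b x = x]].
Proof.
case: (eqVneq x a) => [->|xa]; first by rewrite swL; constructor 1.
case: (eqVneq x b) => [->|xb]; first by rewrite swR; constructor 2.
by constructor 3; split; [apply/eqP | apply/eqP | apply: swD; apply/eqP].
Qed.

Lemma swC (T : eqType) (a b x : T) : sw a b x = sw b a x.
Proof. by rewrite /sw; case: eqP => [->|]; case: eqP. Qed.

Lemma swK (T : eqType) (a b : T) : involutive (sw a b).
Proof.
move=> x; case: (swP a b x) => [[-> _]|[-> _]|[xa xb ->]].
- by rewrite swL swR.
- by rewrite swR swL.
- exact: swD.
Qed.

Lemma sw_inj (T : eqType) (a b : T) : injective (sw a b).
Proof. exact: inv_inj (@swK T a b). Qed.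

Lemma sw_morph (T U : eqType) (f : T -> U) (a b x : T) :
  injective f -> f (sw a b x) = sw (f a) (f b) (f x).
Proof.
by move=> fI; rewrite /sw !(inj_eq fI) !(fun_if f).
Qed.

Lemma sws_morph (T U : eqType) (f : T -> U) ts (x : T) :
  injective f -> f (sws ts x) = sws [seq (f t.1, f t.2) | t <- ts] (f x).
Proof. move=> fI; elim: ts => //= t ts <-; exact: sw_morph. Qed.

Lemma proper_swaps_map (T U : eqType) (f : T -> U) ts :
  injective f -> proper_swaps [seq (f t.1, f t.2) | t <- ts] = proper_swaps ts.
Proof.
by move=> fI; rewrite /proper_swaps all_map; apply: eq_all => t /=; rewrite inj_eq.
Qed.

Lemma sws_cat (T : eqType) (ts us : seq (T * T)) x :
  sws (ts ++ us) x = sws ts (sws us x).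
Proof. by rewrite /sws foldr_cat. Qed.

Lemma sws_inj (T : eqType) (ts : seq (T * T)) : injective (sws ts).
Proof. by elim: ts => //= t ts IH x y /sw_inj /IH. Qed.

(** Swaps of points of [L] preserve [L], so their product restricts to a permutation of a finite
    type, where [odd_perm] is available. *)
Lemma sws_lift (T : choiceType) (L : seq T) (ts : seq (T * T)) :
  proper_swaps ts -> (forall t, t \in ts -> t.1 \in L /\ t.2 \in L) ->
  exists p : {perm seq_sub L}, odd_perm p = odd (size ts) /\
    forall u, ssval (p u) = sws ts (ssval u).
Proof.
elim: ts => [_ _|[a b] ts IH /= /andP[/= ab pts] tsL].
  by exists 1%g; split; [exact: odd_perm1 | move=> u; rewrite perm1].
have [t tts|p [op pE]] := IH pts; first by apply: tsL; rewrite inE tts orbT.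
have [/= aL bL] := tsL (a, b) (mem_head _ _).
(* In [p * q] the factor [p] acts first, so the head swap, which acts last in [sws], stands on the
   right. *)
exists (p * tperm (SeqSub aL) (SeqSub bL))%g; split.
  by rewrite odd_permM odd_tperm op -(inj_eq val_inj) /= ab addbT.
move=> u; rewrite permM -pE /sw -!/(val _) /=.
case: tpermP => [->|->|/eqP ne1 /eqP ne2] /=; rewrite ?eqxx //.
  by case: eqP.
rewrite -!(inj_eq val_inj) /= in ne1 ne2.
by rewrite (negPf ne1) (negPf ne2).
Qed.

(** Both products lift to the same permutation of the finite set [L] of all points they mention, and
    that permutation has one signature. *)
Lemma sws_parity (T : choiceType) (ts us : seq (T * T)) :
  proper_swaps ts -> proper_swaps us -> sws ts =1 sws us ->
  odd (size ts) = odd (size us).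
Proof.
move=> pt pu E.
pose L := [seq t.1 | t <- ts ++ us] ++ [seq t.2 | t <- ts ++ us].
have inL t : t \in ts ++ us -> t.1 \in L /\ t.2 \in L.
  by move=> tin; rewrite !mem_cat !map_f ?orbT.
have [t tin|p [<- pE]] := @sws_lift T L ts pt; first by apply: inL; rewrite mem_cat tin.
have [t tin|q [<- qE]] := @sws_lift T L us pu.
  by apply: inL; rewrite mem_cat tin orbT.
by congr (odd_perm _); apply/permP => u; apply: val_inj; rewrite /= pE qE E.
Qed.

Lemma perm_sws (T : eqType) (n : nat) (f : 'I_n -> T) (p : {perm 'I_n}) (s : T -> T) :
  injective f -> (forall i, s (f i) = f (p i)) ->
  (forall x, (forall i, x <> f i) -> s x = x) ->
  exists ts, [/\ proper_swaps ts, odd (size ts) = odd_perm p & s =1 sws ts].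
Proof.
move=> fI sf sfix; have [us pE pus] := prod_tpermP p.
(* The list is reversed because products in [{perm}] act from left to right and [sws] acts from
   right to left. *)
pose ts := rev [seq (f t.1, f t.2) | t <- us].
exists ts; split.
- by rewrite /proper_swaps all_rev -/(proper_swaps _) proper_swaps_map.
- rewrite size_rev size_map pE; elim: us pus {pE ts} => [|u us IH] /=.
    by rewrite big_nil odd_perm1.
  by case/andP=> u12 /IH ->; rewrite big_cons odd_permM odd_tperm [_ != _]u12.
- have tsE i : sws ts (f i) = f (p i).
    rewrite pE {pE pus} /ts; elim: us i => [|u us IH] i /=.
      by rewrite big_nil perm1.
    rewrite big_cons permM rev_cons -cats1 sws_cat /= -sw_morph // IH.
    congr (f (_ _)); rewrite /sw.
    by case: tpermP => [->|->|/eqP/negPf-> /eqP/negPf->]; rewrite ?eqxx//; case: eqP.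
  move=> x; case: (pselect (exists i, x = f i)) => [[i ->]|nx]; first by rewrite sf tsE.
  have xf i : x <> f i by move=> xi; apply: nx; exists i.
  rewrite sfix //; rewrite /ts -map_rev.
  by elim: (rev us) => //= u vs <-; rewrite swD.
Qed.

(* Swapping [h s] and [b s] after [b] removes [s] from the set where [b] and [h] differ. *)
Lemma agree_off_sws (S T : eqType) (D : T -> Prop) (L : seq S) (h b : S -> T) :
  injective h -> injective b -> (forall x, x \notin L -> b x = h x) ->
  (forall x, h x <> b x -> D (h x) /\ D (b x)) ->
  exists ts, [/\ proper_swaps ts, forall t, t \in ts -> D t.1 /\ D t.2 &
    forall x, sws ts (h x) = b x].
Proof.
move=> hI; elim: L b => [|s L IH] b bI bh hD.
  by exists [::]; split => // x; rewrite bh.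
case: (eqVneq (h s) (b s)) => [E|ne].
  apply: IH => // x xL; case: (eqVneq x s) => [->//|xs].
  by apply: bh; rewrite inE negb_or xs.
have nep : h s <> b s by apply/eqP.
have [Dh Db] := hD _ nep.
pose b' x := sw (h s) (b s) (b x).
have b'x x : x <> s -> (b x = h s /\ b' x = b s) \/ b' x = b x.
  move=> xs; rewrite /b'; case: (swP (h s) (b s) (b x)) => [[]|[/bI//]|[_ _ ->]]; by [left|right].
have [||x|ts [pts tD tsE]] := IH b'.
- by move=> x y /sw_inj /bI.
- move=> x xL; case: (eqVneq x s) => [->|/eqP xs]; first by rewrite /b' swR.
  have bx : b x = h x by apply: bh; rewrite inE negb_or xL andbT; apply/eqP.
  by case: (b'x x xs) => [[+ _]|->//]; rewrite bx => /hI.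
- case: (eqVneq x s) => [->|/eqP xs]; first by rewrite /b' swR.
  case: (b'x x xs) => [[bx ->]|->]; last exact: hD.
  move=> _; split=> //; apply: (hD x _).1; rewrite bx => /hI; exact: xs.
exists ((h s, b s) :: ts); split=> /=; first by rewrite ne.
  by move=> t; rewrite inE => /predU1P[->//|/tD].
by move=> x; rewrite tsE /b' swK.
Qed.

(** * Divisions of the interval and the signature epsilon *)

(** The open interval from [s] to the next point of [S], or to [1] if there is none. No order on the
    list [S] is involved, so points can be added at its head. *)
Definition cell (S : seq R) (s x : R) : Prop :=
  s < x < 1 /\ forall t, t \in S -> t <= s \/ x < t.

Definition division (S : seq R) : Prop :=
  [/\ uniq S, 0 \in S & forall s, s \in S -> X s].

Definition bijX (h : R -> R) : Prop :=
  [/\ injective h, forall y, exists x, h x = y & forall x, X (h x) <-> X x].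

(* The paper's [beta_j] is [b (alpha_j)] and [sigma] is [b o h^-1]; stating that [h] maps cells
   of [S] into cells of [h(S)] replaces left endpoints of images by a condition that is
   visibly stable under composition. *)
Definition straight (h : R -> R) (S : seq R) (b : R -> R) (d : R -> bool) : Prop :=
  [/\ division S, injective b /\ (forall s, s \in S -> b s \in map h S),
      forall x, x \notin S -> b x = h x,
      forall s, s \in S -> forall x, cell S s x -> cell (map h S) (b s) (h x) &
      forall s, s \in S -> forall x y, cell S s x -> cell S s y -> x < y ->
        if d s then h y < h x else h x < h y].

(** The swaps [ts] write [b o h^-1], so their number has the parity of [sigma]; [count d S] is the
    number of decreasing intervals. *)
Definition EpsOn (h : R -> R) (S : seq R) (e : bool) : Prop :=
  exists b d ts, [/\ straight h S b d, proper_swaps ts,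
    forall x, sws ts (h x) = b x & e = odd (size ts) (+) odd (count d S)].

Definition Eps (h : R -> R) (e : bool) : Prop := exists S, EpsOn h S e.

Lemma cell_X S s x : X s -> cell S s x -> X x.
Proof. move=> [s0 s1] [[sx x1] _]; split; lra. Qed.

Lemma cell_notin S s x : cell S s x -> x \notin S.
Proof. by move=> [sx H]; apply/negP => /H; lra. Qed.

Lemma cell_inj S s t x : s \in S -> t \in S -> cell S s x -> cell S t x -> s = t.
Proof. move=> sS tS [? /(_ _ tS) ?] [? /(_ _ sS) ?]; lra. Qed.

Lemma cell_conv S s x y z : cell S s x -> cell S s z -> x <= y <= z -> cell S s y.
Proof.
move=> [? H] [? H'] ?; split; first lra.
by move=> t tS; case: (H _ tS) (H' _ tS); lra.
Qed.

Lemma cell_below S s x y : cell S s x -> s < y <= x -> cell S s y.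
Proof.
by move=> [? H] ?; split; [lra | move=> t /H]; lra.
Qed.

(** The cell starts at the largest point of [S] below [x]. For the induction on [S], membership of
    [0] is weakened to the existence of some point of [S] that is at most [x]. *)
Lemma cell_cover S x : 0 \in S -> X x -> x \notin S ->
  exists2 s, s \in S & cell S s x.
Proof.
move=> S0 [x0 x1] xS.
have [s [sS sx sm]] : exists s, [/\ s \in S, s <= x & forall t, t \in S -> t <= s \/ x < t].
  have : exists2 t, t \in S & t <= x by exists 0.
  elim: S {S0 xS} => [|r S IH] [t]; first by rewrite in_nil.
  case: (pselect (exists2 u, u \in S & u <= x)) => [/IH[s [sS sx sm]]|no].
    move=> _ _; case: (Rle_dec r s) => rs.
      exists s; split; rewrite ?inE ?sS ?orbT // => u; rewrite inE => /predU1P[->|/sm//]; lra.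
    case: (Rle_dec r x) => rx; last first.
      exists s; split; rewrite ?inE ?sS ?orbT // => u; rewrite inE => /predU1P[->|/sm//]; lra.
    exists r; split; rewrite ?inE ?eqxx // => u; rewrite inE => /predU1P[->|/sm]; lra.
  rewrite inE => /predU1P[->|tS] tx; last by case: no; exists t.
  exists r; split; rewrite ?inE ?eqxx // => u; rewrite inE => /predU1P[->|uS]; first lra.
  by case: (Rle_dec u x) => ux; [case: no; exists u | lra].
exists s => //; split=> //; split; last lra.
by case: (Req_dec s x) => [E|]; [rewrite -E sS in xS | lra].
Qed.

Lemma cell_start S s : X s -> exists2 x, s < x & cell S s x.
Proof.
move=> [s0 s1]; elim: S => [|r S [x sx [x1 H]]].
  by exists ((s + 1) / 2); [lra | split=> //; lra].
case: (Rle_dec r s) => rs.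
  by exists x => //; split=> // t; rewrite inE => /predU1P[->|/H]; lra.
exists (Rmin x ((s + r) / 2)); first by apply: Rmin_glb_lt; lra.
have := (Rmin_l x ((s + r) / 2), Rmin_r x ((s + r) / 2)); move=> [? ?].
have ? : s < Rmin x ((s + r) / 2) by apply: Rmin_glb_lt; lra.
split; first lra.
by move=> t; rewrite inE => /predU1P[->|/H]; lra.
Qed.

Lemma cell_cons S s x y : cell (x :: S) s y -> cell S s y.
Proof. by move=> [sy H]; split=> // t tS; apply: H; rewrite inE tS orbT. Qed.

Lemma cell_eq_mem S S' s x : S =i S' -> cell S s x -> cell S' s x.
Proof. by move=> E [sx H]; split=> // t; rewrite -E => /H. Qed.

Lemma bijX_comp g h : bijX g -> bijX h -> bijX (fun x => g (h x)).
Proof.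
move=> [gI gS gX] [hI hS hX]; split.
- by move=> x y /gI /hI.
- by move=> y; have [z <-] := gS y; have [x <-] := hS z; exists x.
- by move=> x; rewrite gX.
Qed.

Lemma PCB_bijX h : PCB h -> bijX h.
Proof.
move=> [hid [hX [hI [hS _]]]].
have hXE x : X (h x) <-> X x.
  split; last exact: hX.
  by move=> Xhx; case: (pselect (X x)) => // nXx; rewrite hid in Xhx.
split=> //.
- move=> x y E; case: (pselect (X x)) => Xx.
    by apply: hI => //; apply/hXE; rewrite -E; apply/hXE.
  have nXy : ~ X y by move=> /hXE; rewrite -E => /hXE.
  by rewrite -(hid _ Xx) -(hid _ nXy).
- move=> y; case: (pselect (X y)) => [/hS[x [_ <-]]|/hid <-]; by eexists.
Qed.

(* In a decreasing cell the new left endpoint [x] takes over the image of [s] and [s] gets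
   [h x]: the extra transposition compensates the extra decreasing interval. *)
Lemma EpsOn_cons h S x e : bijX h -> X x -> x \notin S -> EpsOn h S e -> EpsOn h (x :: S) e.
Proof.
move=> [hI _ hX] Xx xS [b [d [ts [[[uS S0 SX] [bI bT] bh hcell hmon] pts tsE ->]]]].
have [s sS xs] := cell_cover S0 Xx xS.
have [hx1 hx2] := hcell _ sS _ xs; have bx := bh _ xS.
have nsx : s <> x by move=> E; rewrite -E sS in xS.
have nxin t : t \in S -> t <> x by move=> tS E; rewrite -E tS in xS.
pose d' t := if t == x then d s else d t.
have d'x : d' x = d s by rewrite /d' eqxx.
have cellS t y : t \in S -> cell (x :: S) t y -> t = s -> y < x.
  by move=> tS [? /(_ x (mem_head _ _))] ? tE; case: xs; lra.
have cellx y : cell (x :: S) x y -> cell S s y.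
  move=> [? H]; case: xs => ? xs'; split; first lra.
  by move=> t tS; have := xs' _ tS; have := H t; rewrite inE tS orbT => /(_ isT); lra.
have div : division (x :: S).
  split; rewrite /= ?xS ?inE ?S0 ?orbT // => t; rewrite inE => /predU1P[->//|]; exact: SX.
(* Away from [s] the new image point [h x] cuts nothing: between [b t] and [h y] it would lie in the
   cells of both [b t] and [b s], forcing [t = s]. *)
have cellO t y : t \in S -> t <> s -> cell (x :: S) t y -> cell (map h (x :: S)) (b t) (h y).
  move=> tS ts' cty; have [? H] := hcell _ tS _ (cell_cons cty); split=> // u.
  rewrite /= inE => /predU1P[->|/H//].
  case: (Rle_dec (h x) (b t)) => ?; first by left.
  case: (Rle_dec (h x) (h y)) => ?; last by right; lra.
  case: ts'; apply: (@cell_inj S t s x) => //.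
  have cb : cell (map h S) (b t) (h x).
    by split; [lra | move=> v /H; lra].
  have /bI-> // : b t = b s.
  exact: cell_inj (bT _ tS) (bT _ sS) cb (hcell _ sS _ xs).
have mon' t : t \in x :: S -> forall y z, cell (x :: S) t y -> cell (x :: S) t z -> y < z ->
    if d' t then h z < h y else h y < h z.
  rewrite inE /d' => /predU1P[->|tS] y z cy cz yz.
    by rewrite eqxx; apply: hmon => //; exact: cellx.
  by rewrite (introF eqP (nxin _ tS)); apply: hmon => //; apply: cell_cons; eassumption.
have cd : count d' S = count d S.
  by apply: eq_in_count => t tS; rewrite /d' (introF eqP (nxin _ tS)).
case ds: (d s); last first.
  (* On an increasing cell [b] is kept: the image of the left part still starts at [b s], and that
     of the right part starts at [h x = b x]. *)
  exists b, d', ts; split=> //; last by rewrite /= d'x ds cd.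
  split=> //.
  - split=> // t; rewrite /= !inE => /predU1P[->|/bT->]; by rewrite ?bx ?eqxx ?orbT.
  - by move=> y; rewrite inE negb_or => /andP[_ /bh].
  - move=> t; rewrite inE => /predU1P[->|tS] y cy.
      have cy' := cellx _ cy; have [? H] := hcell _ sS _ cy'.
      have := hmon _ sS _ _ xs cy'; rewrite ds bx => mxy.
      split; first by case: cy => ? _; lra.
      by move=> u; rewrite /= inE => /predU1P[->|/H]; [left; lra | lra].
    case: (eqVneq t s) => [E|/eqP ts']; last exact: cellO.
    have yx := cellS _ _ tS cy E; subst t.
    have cy' := cell_cons cy; have [? H] := hcell _ sS _ cy'; split=> // u.
    have := hmon _ sS _ _ cy' xs; rewrite ds => mxy.
    by rewrite /= inE => /predU1P[->|/H//]; right; lra.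
exists (fun y => b (sw s x y)), d', ((b s, b x) :: ts); split=> //; first last.
- by rewrite /= d'x ds cd /= addNb addbN negbK.
- by move=> y; rewrite /= tsE; symmetry; exact: sw_morph.
- by rewrite /= pts andbT (inj_eq bI); apply/eqP.
split=> //.
- split; first by move=> y z /bI /sw_inj.
  move=> t; rewrite /= !inE => /predU1P[->|tS]; first by rewrite swR bT ?orbT.
  case: (eqVneq t s) => [->|/eqP ts']; first by rewrite swL bx eqxx.
  by rewrite swD ?bT ?orbT //; apply: nxin.
- move=> y; rewrite inE negb_or => /andP[/eqP yx yS].
  by rewrite swD // ?bh // => E; rewrite E sS in yS.
- move=> t; rewrite inE => /predU1P[->|tS] y cy.
    have cy' := cellx _ cy; have [? H] := hcell _ sS _ cy'; rewrite swR; split=> // u.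
    have := hmon _ sS _ _ xs cy'; rewrite ds => mxy.
    by rewrite /= inE => /predU1P[->|/H//]; right; case: cy; lra.
  case: (eqVneq t s) => [E|/eqP ts']; last by rewrite swD //; [apply: cellO | apply: nxin].
  have yx := cellS _ _ tS cy E; subst t; rewrite swL bx.
  have cy' := cell_cons cy; have [? H] := hcell _ sS _ cy'.
  have := hmon _ sS _ _ cy' xs; rewrite ds => mxy.
  split; first lra.
  by move=> u; rewrite /= inE => /predU1P[->|/H]; lra.
Qed.

Lemma EpsOn_eq_mem h (S S' : seq R) e : S =i S' -> uniq S' -> EpsOn h S e -> EpsOn h S' e.
Proof.
move=> E uS' [b [d [ts [[[uS S0 SX] [bI bT] bh hcell hmon] pts tsE ->]]]].
have hE : map h S =i map h S' by exact: eq_mem_map.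
have E' y : (y \in S') = (y \in S) by rewrite E.
exists b, d, ts; split=> //; last by rewrite (seq.permP (uniq_perm uS uS' E)).
split.
- by split=> // [|s]; rewrite E' //; exact: SX.
- by split=> // s; rewrite E' -hE; exact: bT.
- by move=> x; rewrite E'; exact: bh.
- move=> s; rewrite E' => sS x cx; apply: (cell_eq_mem hE); apply: hcell => //.
  exact: cell_eq_mem cx.
- move=> s; rewrite E' => sS x y cx cy; apply: hmon => //.
    exact: cell_eq_mem cx.
  exact: cell_eq_mem cy.
Qed.

(** Points are added one at a time and those already present are skipped, hence a result only up to
    [=i]. *)
Lemma EpsOn_cat h S L e : bijX h -> (forall x, x \in L -> X x) -> EpsOn h S e ->
  exists2 S', S' =i L ++ S & EpsOn h S' e.
Proof.
move=> hb; elim: L => [_ H|x L IH LX H]; first by exists S.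
have [y yL|S' SE H'] := IH _ H; first by apply: LX; rewrite inE yL orbT.
have Xx := LX x (mem_head _ _).
case xS: (x \in S').
  by exists S' => // y; rewrite /= inE -SE; case: eqP => // ->.
exists (x :: S'); last exact: EpsOn_cons (negbT xS) H'.
by move=> y; rewrite /= !inE SE.
Qed.

Lemma EpsOn_division h S e : EpsOn h S e -> division S.
Proof. by move=> [b [d [ts [[]]]]]. Qed.

Lemma straight_dir h S b d s x y : straight h S b d -> s \in S ->
  cell S s x -> cell S s y -> x < y -> (h y < h x <-> d s).
Proof.
move=> [_ _ _ _ H] sS cx cy /(H _ sS _ _ cx cy).
by case: (d s) => ?; split=> // ?; lra.
Qed.

(** On a fixed [S] the data are forced: one point of a cell determines [b s] as the start of the
    image cell, and two points determine [d s]. Only the choice of swaps is left, and [sws_parity]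
    settles it. *)
Lemma EpsOn_fun h S e e' : bijX h -> EpsOn h S e -> EpsOn h S e' -> e = e'.
Proof.
move=> [hI hS hX] [b [d [ts [st pts tsE ->]]]] [b' [d' [ts' [st' pts' tsE' ->]]]].
have [[uS S0 SX] [bI bT] bh hcell hmon] := st.
have [_ [bI' bT'] bh' hcell' hmon'] := st'.
have bE x : b x = b' x.
  case: (boolP (x \in S)) => xS; last by rewrite bh // bh'.
  have [y xy cy] := cell_start S (SX _ xS).
  exact: cell_inj (bT _ xS) (bT' _ xS) (hcell _ xS _ cy) (hcell' _ xS _ cy).
have dE : count d S = count d' S.
  apply: eq_in_count => s sS.
  have [y sy cy] := cell_start S (SX _ sS).
  have cz : cell S s ((s + y) / 2) by apply: cell_below cy _; lra.
  have zy : (s + y) / 2 < y by lra.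
  apply/idP/idP => /(straight_dir _ sS cz cy zy).
    by move=> /(_ _ _ st) /(straight_dir st' sS cz cy zy).
  by move=> /(_ _ _ st') /(straight_dir st sS cz cy zy).
rewrite dE; congr addb; apply: sws_parity => // y.
by have [x <-] := hS y; rewrite tsE tsE' bE.
Qed.

Lemma Eps_fun h e e' : bijX h -> Eps h e -> Eps h e' -> e = e'.
Proof.
move=> hb [S H] [S' H'].
have [_ _ SX] := EpsOn_division H; have [_ _ SX'] := EpsOn_division H'.
have [U UE HU] := EpsOn_cat hb SX' H; have [U' UE' HU'] := EpsOn_cat hb SX H'.
apply: (EpsOn_fun hb HU); apply: EpsOn_eq_mem HU'.
  by move=> x; rewrite UE UE' !mem_cat orbC.
by have [] := EpsOn_division HU.
Qed.

(** The division of [h] is refined by the preimage of [Q], then that of [g] is refined to exactly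
    [map h S]. Cells of [S] now go to cells of [map h S], so the two sets of data compose. *)
Lemma Eps_comp g h e e' : bijX g -> bijX h -> Eps g e -> Eps h e' ->
  Eps (fun x => g (h x)) (e (+) e').
Proof.
move=> gb hb [Q HQ] [P HP]; have [hI hS hX] := hb; have [gI gS gX] := gb.
have [k kh] := @choice _ _ (fun y x => h x = y) hS.
have [_ Q0 QX] := EpsOn_division HQ; have [_ _ PX] := EpsOn_division HP.
have [|S SE HS] := @EpsOn_cat h P (map k Q) e' hb _ HP.
  by move=> x /mapP[y /QX Xy ->]; apply/hX; rewrite kh.
have [uS S0 SX] := EpsOn_division HS.
have QT y : y \in Q -> y \in map h S.
  by move=> yQ; rewrite -(kh y) map_f // SE mem_cat map_f.
have {}HQ : EpsOn g (map h S) e.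
  have TX y : y \in map h S -> X y by move=> /mapP[x /SX /hX ? ->].
  have [T TE HT] := EpsOn_cat gb TX HQ.
  apply: EpsOn_eq_mem HT; last by rewrite map_inj_uniq.
  by move=> y; rewrite TE mem_cat; case: (boolP (y \in Q)) => [/QT->|]; rewrite ?orbF.
case: HS => b [d [ts [[_ [bI bT] bh hcell hmon] pts tsE ->]]].
case: HQ => b' [d' [ts' [[[uT T0 TX] [bI' bT'] bh' hcell' hmon'] pts' tsE' ->]]].
exists S, (fun x => b' (b x)), (fun s => d' (b s) (+) d s),
  (* With [c = b o h^-1] and [c' = b' o g^-1], the map [b' o b o (g o h)^-1] equals
     [c' o (g o c o g^-1)]; conjugation by [g] relabels the swaps of [c]. *)
  (ts' ++ [seq (g t.1, g t.2) | t <- ts]).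
split.
- split=> //.
  + split; first by move=> x y /bI' /bI.
    by move=> s sS; rewrite map_comp; apply: bT'; apply: bT.
  + by move=> x xS; rewrite bh // bh' // mem_map.
  + by move=> s sS x cx; rewrite map_comp; apply: hcell' (bT _ sS) _ _; apply: hcell.
  + move=> s sS x y cx cy xy; have := hmon _ sS _ _ cx cy xy.
    have cx' := hcell _ sS _ cx; have cy' := hcell _ sS _ cy; have bs := bT _ sS.
    case: (d s) => hxy.
      by have := hmon' _ bs _ _ cy' cx' hxy; case: (d' (b s)).
    by have := hmon' _ bs _ _ cx' cy' hxy; case: (d' (b s)).
- by rewrite /proper_swaps all_cat [all _ ts']pts' -/(proper_swaps _) proper_swaps_map.
- by move=> x; rewrite sws_cat -sws_morph // tsE tsE'.
- rewrite size_cat size_map oddD.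
  (* The injective [b] maps [S] into [map h S], which has the same size, so it only reorders the
     cells being counted. *)
  have -> : odd (count d' (map h S)) = odd (count (fun s => d' (b s)) S).
    rewrite -(count_map b d'); congr odd; apply/seq.permP.
    have ubS : uniq (map b S) by rewrite map_inj_uniq.
    have sub : {subset map b S <= map h S} by move=> y /mapP[x xS ->]; apply: bT.
    have [|_ bE] := uniq_min_size ubS sub; first by rewrite !size_map.
    by apply: uniq_perm => // y; rewrite bE.
  have -> : odd (count (fun s => d' (b s) (+) d s) S) =
     odd (count (fun s => d' (b s)) S) (+) odd (count d S).
    elim: (S) => //= s L IH; rewrite !oddD !oddb IH.
    by rewrite addbACA.
  by rewrite addbACA.
Qed.

(** * Existence of epsilon, and comparison with its definition by partitions *)

Lemma IVT_value f x y c :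
  (forall z, x <= z <= y -> continuity_pt f z) -> x < y ->
  f x < c < f y \/ f y < c < f x -> exists2 z, x <= z <= y & f z = c.
Proof.
move=> cf xy [fc|fc].
  have [||||z [zxy fz]] := IVT_interv (fun z => f z - c) x y.
  - move=> z zxy; apply: continuity_pt_minus; first exact: cf.
    exact: continuity_pt_const.
  - exact: xy.
  - lra.
  - lra.
  - by exists z => //; lra.
have [||||z [zxy fz]] := IVT_interv (fun z => c - f z) x y.
- move=> z zxy; apply: continuity_pt_minus; last exact: cf.
  exact: continuity_pt_const.
- exact: xy.
- lra.
- lra.
- by exists z => //; lra.
Qed.

(* Slide the pair [u < v] linearly to [x < y]: by continuity the two values of [f] coincide
   at some time, while the points never do. *)
Lemma inj_cont_monotone f lo hi u v x y : injective f ->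
  (forall z, lo <= z <= hi -> continuity_pt f z) ->
  lo <= u -> u < v <= hi -> lo <= x -> x < y <= hi ->
  f u < f v -> f y < f x -> False.
Proof.
move=> fI cf lu uv lx xy fuv fyx.
have aff p q : continuity (fun t => p + t * (q - p)) by move=> t; reg.
have bnd p q t : lo <= p <= hi -> lo <= q <= hi -> 0 <= t <= 1 -> lo <= p + t * (q - p) <= hi.
  by move=> ? ? ?; split; nra.
pose phi t := f (v + t * (y - v)) - f (u + t * (x - u)).
have [|||t t01 /Rminus_diag_uniq/fI E] := @IVT_value phi 0 1 0.
- move=> t t01; apply: continuity_pt_minus.
    apply: (continuity_pt_comp (fun t => v + t * (y - v)) f); first exact: aff.
    by apply: cf; apply: bnd => //; lra.
  apply: (continuity_pt_comp (fun t => u + t * (x - u)) f); first exact: aff.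
  by apply: cf; apply: bnd => //; lra.
- lra.
- right; rewrite /phi !Rmult_0_l !Rplus_0_r !Rmult_1_l !Rplus_minus; lra.
have ? : (1 - t) * (v - u) + t * (y - x) = 0 by nra.
by case: (Rle_dec t (1 / 2)) => ?; nra.
Qed.

(** On a cell [h] is injective and continuous, hence monotone. By the intermediate value theorem no
    point of [map h S] separates two values taken on one cell, so the image of a cell lies in a
    single cell of [map h S]; [b] picks the start of that cell. *)
Lemma straight_exists h S : bijX h -> division S ->
  (forall x, X x -> x \notin S -> continuity_pt h x) -> exists b d, straight h S b d.
Proof.
move=> [hI hS hX] [uS S0 SX] hc.
have cc s x y : s \in S -> cell S s x -> cell S s y ->
    forall z, x <= z <= y -> continuity_pt h z.
  move=> sS cx cy z /(cell_conv cx cy) cz; apply: hc; last exact: cell_notin cz.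
  exact: cell_X (SX _ sS) cz.
pose d s : bool := `[< exists x y, [/\ cell S s x, cell S s y, x < y & h y < h x] >].
have mon s : s \in S -> forall x y, cell S s x -> cell S s y -> x < y ->
    if d s then h y < h x else h x < h y.
  move=> sS x y cx cy xy; rewrite /d; case: asboolP => [[u [v [cu cv uv huv]]]|nd].
    case: (Rtotal_order (h x) (h y)) => [hxy|[/hI|//]]; last lra.
    exfalso; have clo : cell S s (Rmin x u) by rewrite /Rmin; case: Rle_dec.
    have chi : cell S s (Rmax y v) by rewrite /Rmax; case: Rle_dec.
    have := (Rmin_l x u, Rmin_r x u); have := (Rmax_l y v, Rmax_r y v) => -[? ?] [? ?].
    apply: (@inj_cont_monotone h _ _ x y u v hI (cc _ _ _ sS clo chi)) => //; lra.
  case: (Rtotal_order (h x) (h y)) => [//|[/hI|hxy]]; first lra.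
  by case: nd; exists x, y.
have TX t : t \in map h S -> X t by move=> /mapP[s /SX /hX ? ->].
(* If [0] were the value at an interior point of a cell, strict monotonicity would give negative
   values nearby. *)
have T0 : 0 \in map h S.
  have [x hx0] := hS 0; have Xx : X x by apply/hX; rewrite hx0; split; lra.
  case xS : (x \in S); first by rewrite -hx0 map_f.
  have [s sS cx] := cell_cover S0 Xx (negbT xS).
  have [y cy ny] : exists2 y, cell S s y & h y < h x.
    have [[sx x1] H] := cx.
    have cl : cell S s ((s + x) / 2) by apply: (cell_below cx); lra.
    have [z xz cz] : exists2 z, x < z & cell S s z.
      have [z xz [? Hz]] := cell_start S Xx; exists z => //; split; first lra.
      by move=> t tS; case: (H _ tS) (Hz _ tS); lra.
    have ml : (s + x) / 2 < x by lra.
    have := mon _ sS _ _ cl cx ml; have := mon _ sS _ _ cx cz xz.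
    by case: (d s); [exists z | exists ((s + x) / 2)].
  have [] : X (h y) by apply/hX; exact: cell_X (SX _ sS) cy.
  by lra.
have same s x y t : s \in S -> cell S s x -> cell S s y -> x < y -> t \in map h S ->
    cell (map h S) t (h x) <-> cell (map h S) t (h y).
  move=> sS cx cy xy tT.
  have sep u : u \in map h S -> ~ (h x < u < h y \/ h y < u < h x).
    move=> /mapP[r rS ->] /(IVT_value (cc _ _ _ sS cx cy) xy)[z zxy /hI E].
    by have := cell_notin (cell_conv cx cy zxy); rewrite E rS.
  have nT z : cell S s z -> forall u, u \in map h S -> h z <> u.
    by move=> cz u /mapP[r rS ->] /hI E; have := cell_notin cz; rewrite E rS.
  have [hx0 hx1] : X (h x) by apply/hX; exact: cell_X (SX _ sS) cx.
  have [hy0 hy1] : X (h y) by apply/hX; exact: cell_X (SX _ sS) cy.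
  have side u : u \in map h S -> (u < h x <-> u < h y).
    by move=> uT; have := sep _ uT; have := nT _ cx _ uT; have := nT _ cy _ uT; split; lra.
  split=> -[th H]; (split; [by have := side _ tT; lra | move=> u uT]).
    by have := side _ uT; have := nT _ cy _ uT; case: (H _ uT); lra.
  by have := side _ uT; have := nT _ cx _ uT; case: (H _ uT); lra.
have ex s : exists t, s \in S -> t \in map h S /\
    forall x, cell S s x -> cell (map h S) t (h x).
  case sS : (s \in S); last by exists 0.
  have [x sx cx] := cell_start S (SX _ sS).
  have Xhx : X (h x) by apply/hX; exact: cell_X (SX _ sS) cx.
  have hxT : h x \notin map h S by rewrite mem_map //; exact: cell_notin cx.
  have [t tT ct] := cell_cover T0 Xhx hxT; exists t => _; split=> // y cy.
  case: (Rtotal_order x y) => [xy|[<-//|yx]].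
    exact/(same _ _ _ _ sS cx cy xy tT).
  exact/(same _ _ _ _ sS cy cx yx tT).
have [b0 b0P] := choice ex.
(* Every cell of [map h S] contains some [h y] with [y] in a cell of [S], so its start is reached.
   Equal sizes then make [b0] injective on [S]. *)
have b0onto : {subset map h S <= map b0 S}.
  move=> t tT; have [z tz cz] := cell_start (map h S) (TX _ tT).
  have [y hy] := hS z; subst z.
  have yS : y \notin S by rewrite -(mem_map hI) (cell_notin cz).
  have [s sS cy] : exists2 s, s \in S & cell S s y.
    by apply: cell_cover => //; apply/hX; exact: cell_X (TX _ tT) cz.
  have [bsT H] := b0P _ sS.
  by rewrite -(cell_inj bsT tT (H _ cy) cz) map_f.
have ub0 : uniq (map b0 S).
  by apply: leq_size_uniq b0onto _; rewrite ?map_inj_uniq // !size_map.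
have b0I : {in S &, injective b0}.
  move=> s t sS tS E; rewrite -(nth_index 0 sS) -(nth_index 0 tS); congr nth.
  apply/eqP; rewrite -(nth_uniq 0 _ _ ub0) ?size_map ?index_mem //.
  by rewrite !(nth_map 0) ?index_mem // !nth_index // E.
exists (fun x => if x \in S then b0 x else h x), d.
split=> //.
- split; last by move=> s sS; rewrite sS; exact: (b0P _ sS).1.
  have cr x y : x \in S -> y \notin S -> b0 x <> h y.
    by move=> xS yS E; have := (b0P _ xS).1; rewrite E mem_map // (negPf yS).
  move=> x y; case: ifPn => xS; case: ifPn => yS; [exact: b0I | | | exact: hI].
    by move/(cr _ _ xS yS).
  by move/esym/(cr _ _ yS xS).
- by move=> x /negPf->.
- by move=> s sS; rewrite sS; exact: (b0P _ sS).2.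
Qed.

Lemma straight_sws h S b d : bijX h -> straight h S b d ->
  exists2 ts, proper_swaps ts & forall x, sws ts (h x) = b x.
Proof.
move=> [hI _ _] [_ [bI _] bh _ _].
by have [//|ts [pts _ tsE]] := agree_off_sws (D := fun=> True) hI bI bh; exists ts.
Qed.

(** This identifies [b s] with the left endpoint [beta]: points just above [b s] lie in its cell,
    and their preimages lie in the cell of [s] because [b] is injective. *)
Lemma straight_inf h S b d s : bijX h -> straight h S b d -> s \in S ->
  is_inf (fun y => exists x, cell S s x /\ h x = y) (b s).
Proof.
move=> [hI hS hX] [[uS S0 SX] [bI bT] bh hcell hmon] sS.
have Xb : X (b s) by case/mapP: (bT _ sS) => t /SX /hX ? ->.
split; first by move=> y [x [/(hcell _ sS) [? _] <-]]; lra.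
move=> c H; apply: Rnot_lt_le => bc.
have [z bz cz] := cell_start (map h S) Xb.
pose y := (b s + Rmin z c) / 2.
have ? : b s < Rmin z c by apply: Rmin_glb_lt.
have [? ?] := (Rmin_l z c, Rmin_r z c).
have cy : cell (map h S) (b s) y by apply: (cell_below cz); rewrite /y; lra.
have [x hx] := hS y.
have xS : x \notin S by rewrite -(mem_map hI) hx (cell_notin cy).
have [t tS cx] : exists2 t, t \in S & cell S t x.
  by apply: cell_cover => //; apply/hX; rewrite hx; exact: cell_X Xb cy.
have cy' := hcell _ tS _ cx; rewrite hx in cy'.
have ts : t = s by apply: bI; exact: cell_inj (bT _ tS) (bT _ sS) cy' cy.
subst t; have : c <= y by apply: H; exists x.
rewrite /y; lra.
Qed.

Lemma is_inf_unique P x y : is_inf P x -> is_inf P y -> x = y.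
Proof. by move=> [lx gx] [ly gy]; apply: Rle_antisym; [apply: gy | apply: gx]. Qed.

Lemma is_inf_ext (P Q : R -> Prop) x : (forall y, P y <-> Q y) -> is_inf P x -> is_inf Q x.
Proof. by move=> E [l g]; split=> [y /E/l//|c H]; apply: g => y /E/H. Qed.

(** * Increasing partitions and the defining formula of epsilon *)

Lemma partition_lft_le a (i j : 'I_(size a)) : is_partition a -> (i <= j)%N -> lft a i <= lft a j.
Proof.
move=> [_ [_ [_ H]]]; rewrite leq_eqVlt => /predU1P[->|/H/Rlt_le//]; exact: Rle_refl.
Qed.

Lemma partition_lft_inj a : is_partition a -> injective (fun i : 'I_(size a) => lft a i).
Proof.
move=> [_ [_ [_ H]]] i j E; apply: val_inj.
by case: (ltngtP i j) => // /H; rewrite E => ?; exfalso; lra.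
Qed.

Lemma partition_memP a x : x \in a -> exists i : 'I_(size a), lft a i = x.
Proof. by case/(nthP 0) => i ia <-; exists (Ordinal ia). Qed.

Lemma partition_division a : is_partition a -> division a.
Proof.
move=> pa; have [a0 [l0 [aX _]]] := pa; split.
- apply/(uniqP 0) => i j ia ja E.
  by have /(congr1 val) := partition_lft_inj pa (x1 := Ordinal ia) (x2 := Ordinal ja) E.
- by rewrite -l0 mem_nth.
- by move=> s /partition_memP[i <-].
Qed.

Lemma partition_cell a (j : 'I_(size a)) x : is_partition a ->
  (lft a j < x < rgt a j <-> cell a (lft a j) x).
Proof.
move=> pa; have [a0 [l0 [aX aM]]] := pa.
(* For the last interval [rgt] falls back on its default [1], the upper bound built into [cell]. *)
have rE (jS : (j.+1 < size a)%N) : rgt a j = lft a (Ordinal jS) by exact: set_nth_default.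
split=> [[lx xr]|[lx H]].
  split.
    case: (ltnP j.+1 (size a)) => jS; last by rewrite /rgt nth_default in xr.
    by have := aX (Ordinal jS); rewrite -rE => -[]; lra.
  move=> t /partition_memP[k <-]; case: (leqP k j) => kj.
    by left; exact: partition_lft_le.
  have jS : (j.+1 < size a)%N by exact: leq_ltn_trans kj (ltn_ord k).
  by right; apply: Rlt_le_trans xr _; rewrite rE; exact: partition_lft_le.
split; first lra.
case: (ltnP j.+1 (size a)) => jS; last by rewrite /rgt nth_default //; lra.
rewrite rE; have /= := aM j (Ordinal jS) (ltnSn j).
by have := H (lft a (Ordinal jS)) (mem_nth _ jS); rewrite /=; lra.
Qed.

Lemma assoc_partition_straight h a : bijX h -> assoc_partition h a ->
  exists b d, straight h a b d.
Proof.
move=> hb [pa hc]; have da := partition_division pa; apply: straight_exists => // x Xx xa.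
have [_ a0 _] := da; have [s /partition_memP[j <-] cx] := cell_cover a0 Xx xa.
by apply: (hc j); apply/partition_cell.
Qed.

Lemma count_ord (T : Type) (x0 : T) (P : pred T) (a : seq T) :
  count P a = #|[pred j : 'I_(size a) | P (nth x0 a j)]|.
Proof.
rewrite -[in LHS](mkseq_nth x0 a) /mkseq -val_enum_ord -map_comp count_map cardE.
by rewrite size_filter -enumT; apply: eq_count.
Qed.

(** Uniqueness of infima gives [b = beta] at left endpoints, and two test points per cell compare
    the directions. Along [j |-> h (lft a j)] the permutation [p] becomes [b o h^-1]. *)
Lemma eps_part_Eps h a e : bijX h -> assoc_partition h a -> eps_part h a e -> Eps h e.
Proof.
move=> hb aa [d [beta [p [dT [dF [binf [pE ->]]]]]]].
have [b [d0 st]] := assoc_partition_straight hb aa.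
have [us pus usE] := straight_sws hb st.
have [pa _] := aa; have [hI hS hX] := hb.
have [[ua a0 aX] [bI bT] bh _ _] := st.
have la (j : 'I_(size a)) : lft a j \in a by exact: mem_nth.
have betaE (j : 'I_(size a)) : b (lft a j) = beta j.
  apply: is_inf_unique (binf j); apply: is_inf_ext (straight_inf hb st (la j)) => y.
  by split=> -[x [cx hx]]; exists x; split=> //; apply/(partition_cell j x pa).
have dE (j : 'I_(size a)) : d j = d0 (lft a j).
  have [y sy cy] := cell_start a (aX _ (la j)).
  have cz : cell a (lft a j) ((lft a j + y) / 2) by apply: (cell_below cy); lra.
  have zy : (lft a j + y) / 2 < y by lra.
  have [cz1 cz2] := (partition_cell j _ pa).2 cz; have [cy1 cy2] := (partition_cell j _ pa).2 cy.
  have E := straight_dir st (la j) cz cy zy.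
  case dj: (d j); symmetry; first by apply/E; apply: (dT j).
  by apply/negbTE/negP => /E; have := dF j (negbT dj) _ _ cz1 zy cy2; lra.
have [|i|x nx|ts [pts tsp usts]] := @perm_sws _ _ (fun j : 'I_(size a) => h (lft a j)) p (sws us).
- by move=> i j /hI /(partition_lft_inj pa).
- by rewrite usE betaE pE.
- have [y hy] := hS x; subst x; rewrite usE bh //.
  by apply/negP => /partition_memP[j jE]; apply: (nx j); rewrite jE.
exists a, b, d0, ts; split=> //; first by move=> x; rewrite -usts usE.
rewrite oddD addbC tsp oddb; congr (_ (+) odd _).
by rewrite (count_ord 0); apply: eq_card => j; rewrite !inE dE.
Qed.

Lemma eps_part_exists h a : bijX h -> assoc_partition h a -> exists e, eps_part h a e.
Proof.
move=> hb aa; have [b [d st]] := assoc_partition_straight hb aa.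
have [pa _] := aa; have [hI hS hX] := hb.
have [[ua a0 aX] [bI bT] bh _ hmon] := st.
have la (j : 'I_(size a)) : lft a j \in a by exact: mem_nth.
have ex (j : 'I_(size a)) : exists k : 'I_(size a), h (lft a k) = b (lft a j).
  by case/mapP: (bT _ (la j)) => s /partition_memP[k <-] ->; exists k.
have [f fE] := choice ex.
have fI : injective f.
  by move=> i j E; apply: (partition_lft_inj pa); apply: bI; rewrite -!fE E.
exists (odd (#|[pred j : 'I_(size a) | d (lft a j)]| + odd_perm (perm fI))).
exists (fun j => d (lft a j)), (fun j => b (lft a j)), (perm fI).
have between (j : 'I_(size a)) x y : lft a j < x -> x < y -> y < rgt a j ->
    cell a (lft a j) x /\ cell a (lft a j) y.
  by move=> ? ? ?; split; apply/(partition_cell j _ pa); lra.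
split; [|split; [|split; [|split]]] => //.
- move=> j dj x y lx xy yr; have [cx cy] := between _ _ _ lx xy yr.
  by have := hmon _ (la j) _ _ cx cy xy; rewrite dj.
- move=> j /negbTE dj x y lx xy yr; have [cx cy] := between _ _ _ lx xy yr.
  by have := hmon _ (la j) _ _ cx cy xy; rewrite dj.
- move=> j; apply: is_inf_ext (straight_inf hb st (la j)) => y.
  by split=> -[x [cx hx]]; exists x; split=> //; apply/(partition_cell j x pa).
- by move=> j; rewrite permE fE.
Qed.

Lemma division_partition S : division S -> exists2 a, is_partition a & a =i S.
Proof.
move=> [uS S0 SX].
pose le (x y : R) : bool := `[< x <= y >].
have le_total : total le.
  by move=> x y; apply/orP; case: (Rle_dec x y) => ?; [left|right]; apply/asboolP; lra.
have le_trans : transitive le.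
  by move=> y x z /asboolP xy /asboolP yz; apply/asboolP; lra.
have aS : sort le S =i S by move=> x; rewrite mem_sort.
have ua : uniq (sort le S) by rewrite sort_uniq.
have lt i j : (i < j)%N -> (j < size (sort le S))%N ->
    nth 0 (sort le S) i < nth 0 (sort le S) j.
  move=> ij ja; have ia := ltn_trans ij ja.
  have /asboolP ? := sorted_ltn_nth le_trans 0 (sort_sorted le_total S) _ _ ia ja ij.
  have /eqP ? : nth 0 (sort le S) i != nth 0 (sort le S) j.
    by rewrite nth_uniq // ltn_eqF.
  lra.
have aX j : (j < size (sort le S))%N -> X (nth 0 (sort le S) j).
  by move=> ja; apply: SX; rewrite -aS mem_nth.
exists (sort le S) => //.
have a0 : (0 < size (sort le S))%N by rewrite size_sort; case: (S) S0.
split=> //; split; last by split=> [j|i j ij]; [apply: aX | apply: lt].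
have /(nthP 0)[[//|i] ia i0] : 0 \in sort le S by rewrite aS.
have := lt 0%N i.+1 isT ia; have [] := aX _ a0; rewrite i0 /lft; lra.
Qed.

Lemma InP (T : eqType) (x : T) (s : seq T) : reflect (List.In x s) (x \in s).
Proof.
elim: s => [|y s IH] /=; first by rewrite in_nil; constructor.
rewrite inE; apply: (iffP predU1P) => [[->|/IH]|[->|/IH]]; by [left|right].
Qed.

Lemma NoDup_uniq (T : eqType) (s : seq T) : List.NoDup s -> uniq s.
Proof. by elim=> //= x t xt _ ->; rewrite andbT; apply/InP. Qed.

Lemma PCB_assoc_partition h : PCB h -> exists a, assoc_partition h a.
Proof.
move=> [_ [hX [_ [_ [F hF]]]]].
pose S := undup (0 :: [seq x <- F | `[< X x >]]).
have [|a pa aS] := @division_partition S.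
  split; rewrite ?undup_uniq ?mem_undup ?inE ?eqxx // => s.
  rewrite mem_undup inE mem_filter => /predU1P[->|/andP[/asboolP//]]; split; lra.
exists a; split=> // j x /(partition_cell j x pa) cx.
have [_ _ aX] := partition_division pa.
have Xx : X x by apply: cell_X cx; apply: aX; exact: mem_nth.
have := cell_notin cx; rewrite aS mem_undup inE negb_or mem_filter => /andP[/eqP x0].
rewrite (asboolT Xx) /= => /InP xF e e0; have [dl [dl0 H]] := hF _ Xx xF _ e0.
have [? ?] := Xx.
(* The radius keeps [y] inside [X], where [cont_within_X] applies; it is positive because [0] is a
   division point, so [x > 0]. *)
exists (Rmin dl (Rmin x (1 - x))); split.
  by apply: Rmin_glb_lt => //; apply: Rmin_glb_lt; lra.
rewrite /= /Rdist => y [_ yx].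
have [? ?] := (Rmin_l dl (Rmin x (1 - x)), Rmin_r dl (Rmin x (1 - x))).
have [? ?] := (Rmin_l x (1 - x), Rmin_r x (1 - x)).
apply: H; last lra.
have /Rabs_def2[? ?] : Rabs (y - x) < Rmin x (1 - x) by lra.
split; lra.
Qed.

Lemma Eps_exists h : PCB h -> exists e, Eps h e.
Proof.
move=> ph; have [a aa] := PCB_assoc_partition ph; have hb := PCB_bijX ph.
by have [e /(eps_part_Eps hb aa)] := eps_part_exists hb aa; exists e.
Qed.

(** A partition of least size exists because sizes are natural numbers, and [Eps_fun] identifies the
    value computed on it. *)
Lemma eps_val_Eps h e : PCB h -> (eps_val h e <-> Eps h e).
Proof.
move=> ph; have hb := PCB_bijX ph; split=> [[a [aa [_]]]|he]; first exact: eps_part_Eps.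
have ex : exists n, `[< exists2 a, assoc_partition h a & size a = n >].
  by have [a aa] := PCB_assoc_partition ph; exists (size a); apply/asboolP; exists a.
case: (ex_minnP ex) => n /asboolP[a aa <-] amin.
exists a; split=> //; split=> [a' aa'|]; first by apply: amin; apply/asboolP; exists a'.
have [e' pe'] := eps_part_exists hb aa.
by rewrite (Eps_fun hb he (eps_part_Eps hb aa pe')).
Qed.

(** On the division by [0], [x], [y] one takes [b = id] and no decreasing cell, so [b o h^-1] is the
    transposition itself. *)
Lemma Eps_sw x y : X x -> X y -> x <> y -> Eps (sw x y) true.
Proof.
move=> Xx Xy xy; pose S := undup [:: 0; x; y].
have xS : x \in S by rewrite mem_undup !inE eqxx orbT.
have yS : y \in S by rewrite mem_undup !inE eqxx !orbT.
have hS : map (sw x y) S =i S.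
  have swS z : (sw x y z \in S) = (z \in S).
    by case: (swP x y z) => [[-> ->]|[-> ->]|[_ _ ->]]; rewrite ?xS ?yS.
  by move=> z; rewrite -(swK x y z) mem_map ?swS //; exact: sw_inj.
have nS z : z \notin S -> sw x y z = z.
  by move=> zS; apply: swD => E; move: zS; rewrite E ?xS ?yS.
exists S, id, (fun=> false), [:: (x, y)]; split=> //.
- split=> //.
  + split; rewrite ?undup_uniq ?mem_undup ?inE ?eqxx // => s.
    by rewrite mem_undup !inE => /or3P[]/eqP-> //; split; lra.
  + by split=> // s; rewrite hS.
  + by move=> z /nS.
  + move=> s sS z cz; rewrite nS; last exact: cell_notin cz.
    by apply: cell_eq_mem cz => u; rewrite hS.
  + by move=> s sS u v /cell_notin/nS-> /cell_notin/nS->.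
- by rewrite /= andbT; apply/eqP.
- by move=> z; exact: swK.
- by rewrite count_pred0.
Qed.

(** * Finitely supported permutations as products of transpositions *)

Lemma sws_fix (T : eqType) (ts : seq (T * T)) x :
  x \notin map fst ts -> x \notin map snd ts -> sws ts x = x.
Proof.
elim: ts => //= t ts IH; rewrite !inE !negb_or => /andP[/eqP x1 xt1] /andP[/eqP x2 xt2].
by rewrite IH // swD.
Qed.

Lemma sgn_relP h e :
  sgn_rel h e <-> exists ts, [/\ proper_swaps ts, odd (size ts) = e & h =1 sws ts].
Proof.
have dir k c : sgn_rel k c -> exists ts, [/\ proper_swaps ts, odd (size ts) = c & k =1 sws ts].
  move=> [L [p [uL [kL [kp <-]]]]]; apply: (perm_sws (f := fun i : 'I_(size L) => nth 0 L i)) => //.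
    move=> i j E; apply: val_inj.
    by apply/eqP; rewrite -(nth_uniq 0 (ltn_ord i) (ltn_ord j) (NoDup_uniq uL)) E.
  by move=> x xL; apply: kL => /InP/(nthP 0)[i iL ix]; apply: (xL (Ordinal iL)).
split; first exact: dir.
move=> [ts [pts <- hts]].
pose L := undup (map fst ts ++ map snd ts).
have hI : injective h by move=> x y; rewrite !hts => /sws_inj.
have hfix x : x \notin L -> h x = x.
  by rewrite mem_undup mem_cat negb_or hts => /andP[]; exact: sws_fix.
have hL x : x \in L -> h x \in L.
  by move=> xL; apply/negPn/negP => hxL; have /hI E := hfix _ hxL; rewrite E xL in hxL.
have uL : uniq L by exact: undup_uniq.
have ex (i : 'I_(size L)) : exists j : 'I_(size L), h (nth 0 L i) = nth 0 L j.
  by have /(nthP 0)[j jL <-] := hL _ (mem_nth 0 (ltn_ord i)); exists (Ordinal jL).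
have [f fE] := choice ex.
have fI : injective f.
  move=> i j E; apply/val_inj/eqP; rewrite -(nth_uniq 0 (ltn_ord i) (ltn_ord j) uL).
  by apply/eqP/hI; rewrite !fE E.
have rel : sgn_rel h (odd_perm (perm fI)).
  exists L, (perm fI); split; [|split; [|split]] => //.
  - by elim: (L) uL => [_|x s IH /= /andP[/InP xs /IH]]; constructor.
  - by move=> x /InP/hfix.
  - by move=> i; rewrite permE.
(* The parity of the induced permutation is found by decomposing it back into swaps and comparing
   with [ts]. *)
have [us [pus usE hus]] := dir _ _ rel.
have <- : odd (size us) = odd (size ts) by apply: sws_parity => // x; rewrite -hus hts.
by rewrite usE.
Qed.

Definition swaps_in_X (ts : seq (R * R)) : Prop :=
  proper_swaps ts /\ forall t, t \in ts -> X t.1 /\ X t.2.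

Lemma isolated (F : seq R) x : exists2 dl, 0 < dl &
  forall y, Rabs (y - x) < dl -> y \in F -> y = x.
Proof.
elim: F => [|z F [dl dl0 H]]; first by exists 1; [lra | move=> y; rewrite in_nil].
case: (Req_dec z x) => [->|zx].
  by exists dl => // y yx; rewrite inE => /predU1P[//|]; apply: H.
have ? : 0 < Rabs (z - x) by apply: Rabs_pos_lt; lra.
exists (Rmin dl (Rabs (z - x))); first exact: Rmin_glb_lt.
have [? ?] := (Rmin_l dl (Rabs (z - x)), Rmin_r dl (Rabs (z - x))).
move=> y yx; rewrite inE => /predU1P[E|]; first by rewrite E in yx; lra.
by apply: H; lra.
Qed.

Lemma SfinP h : Sfin h <-> exists2 ts, swaps_in_X ts & h =1 sws ts.
Proof.
split=> [[ph [F hF]]|[ts [pts tX] hts]].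
  have [hI _ hX] := PCB_bijX ph; have [hid _] := ph.
  have [||ts [pts tsX tsE]] := @agree_off_sws _ _ X F id h (fun x y => id) hI.
  - by move=> x /InP xF; exact: hF.
  - move=> x /= xh; case: (pselect (X x)) => [Xx|/hid/esym//]; by split=> //; apply/hX.
  by exists ts => // x; rewrite tsE.
have tX1 x : x \in map fst ts -> X x by move=> /mapP[t /tX[? ?] ->].
have tX2 x : x \in map snd ts -> X x by move=> /mapP[t /tX[? ?] ->].
pose F := map fst ts ++ map snd ts.
have hF x : x \notin F -> h x = x.
  by rewrite mem_cat negb_or hts => /andP[]; exact: sws_fix.
have hI : injective h by move=> x y; rewrite !hts => /sws_inj.
have FX x : x \in F -> X x by rewrite mem_cat => /orP[/tX1|/tX2].
have hid x : ~ X x -> h x = x.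
  by move=> nX; apply: hF; apply/negP => /FX.
have hX x : X x -> X (h x).
  move=> Xx; apply: contrapT => nX; have /hI E := hid _ nX; by rewrite E in nX.
split; last by exists F => x /InP; exact: hF.
split=> //; split=> //; split; first by move=> x y _ _; exact: hI.
split.
  move=> y Xy; exists (sws (rev ts) y).
  have hK : h (sws (rev ts) y) = y.
    rewrite hts; elim: (ts) y {Xy} => //= t us IH y.
    by rewrite rev_cons -cats1 sws_cat /= IH swK.
  split=> //; apply: contrapT => nX; have := hid _ nX; rewrite hK => E; by rewrite -E in nX.
(* Around a point outside [F] some ball avoids [F], and there [h] is the identity. *)
exists F => x Xx /InP xF e e0; have [dl dl0 H] := isolated F x.
exists (Rmin dl e); split; first exact: Rmin_glb_lt.
have [? ?] := (Rmin_l dl e, Rmin_r dl e).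
move=> y Xy yx; rewrite (hF _ xF) hF; first lra.
apply/negP => yF; have E : y = x by apply: H => //; lra.
by rewrite -E yF in xF.
Qed.

Lemma AfinP h : Afin h <-> exists2 ts, swaps_in_X ts /\ ~~ odd (size ts) & h =1 sws ts.
Proof.
split=> [[/SfinP[ts [pts tX] hts] /sgn_relP[us [pus uE hus]]]|[ts [[pts tX] ev] hts]].
  exists ts => //; split=> //.
  by rewrite (@sws_parity _ ts us) ?uE // => x; rewrite -hts hus.
split; first by apply/SfinP; exists ts.
by apply/sgn_relP; exists ts; split=> //; exact/negbTE.
Qed.

(** * Normal subgroups *)

Lemma pred_eq1 (A : (R -> R) -> Prop) f g : f =1 g -> A f -> A g.
Proof. by move=> /funext->. Qed.

Lemma same_set_eq A B : same_set A B -> A = B.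
Proof. by move=> AB; apply/funext => h; apply/propext. Qed.

Lemma fresh (L : seq R) : exists2 x, X x & forall y, y \in L -> x <> y.
Proof.
have X0 : X 0 by split; lra.
have [x _ cx] := cell_start L X0; exists x; first exact: cell_X X0 cx.
by move=> y yL E; have := cell_notin cx; rewrite E yL.
Qed.

Lemma swaps_in_X_cons a b ts : a <> b -> X a -> X b -> swaps_in_X ts ->
  swaps_in_X ((a, b) :: ts).
Proof.
move=> ab Xa Xb [pts tX]; split; first by rewrite /= pts andbT; apply/eqP.
by move=> t; rewrite inE => /predU1P[->//|/tX].
Qed.

Lemma Sfin_sws ts : swaps_in_X ts -> Sfin (sws ts).
Proof. by move=> tX; apply/SfinP; exists ts. Qed.

Lemma Sfin_sw a b : a <> b -> X a -> X b -> Sfin (sw a b).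
Proof.
by move=> ab Xa Xb; apply: (Sfin_sws (ts := [:: (a, b)])); apply: swaps_in_X_cons.
Qed.

Lemma Sfin_bijX s : Sfin s -> bijX s.
Proof. by case=> /PCB_bijX. Qed.

Lemma Eps_sws ts : swaps_in_X ts -> Eps (sws ts) (odd (size ts)).
Proof.
elim: ts => [_|[a b] ts IH [/= /andP[/eqP /= ab pts] tX]].
  (* The identity is even as the square of a transposition. *)
  have [X0 X1] : X 0 /\ X (1 / 2) by split; split; lra.
  have ne : 0 <> 1 / 2 by lra.
  have E := Eps_sw X0 X1 ne; have sb := Sfin_bijX (Sfin_sw ne X0 X1).
  by apply: (pred_eq1 (A := Eps^~ false) _ (Eps_comp sb sb E E)) => x; exact: swK.
have [Xa Xb] := tX (a, b) (mem_head _ _).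
have tsX : swaps_in_X ts by split=> // t tin; apply: tX; rewrite inE tin orbT.
have := Eps_comp (Sfin_bijX (Sfin_sw ab Xa Xb)) (Sfin_bijX (Sfin_sws tsX))
  (Eps_sw Xa Xb ab) (IH tsX).
by rewrite addTb.
Qed.

Lemma Afin_Eps s : Afin s <-> Sfin s /\ Eps s false.
Proof.
split=> [/AfinP[ts [tX ev] /funext->]|[/SfinP[ts tX /funext->] E]].
  by split; [exact: Sfin_sws | rewrite -(negbTE ev); exact: Eps_sws].
apply/AfinP; exists ts => //; split=> //; apply/negbT.
exact: Eps_fun (Sfin_bijX (Sfin_sws tX)) (Eps_sws tX) E.
Qed.

(** The homomorphism property read on the kernel: a product is even exactly when both factors are
    even or both are odd. Characters to [Z/2] are handled below in this form. *)
Lemma Eps_even_comp g h : PCB g -> PCB h ->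
  (Eps (fun x => g (h x)) false <-> (Eps g false <-> Eps h false)).
Proof.
move=> pg ph; have [e ge] := Eps_exists pg; have [e' he'] := Eps_exists ph.
have gb := PCB_bijX pg; have hb := PCB_bijX ph.
have gh := Eps_comp gb hb ge he'; have ghb := bijX_comp gb hb.
have val k c : bijX k -> Eps k c -> (Eps k false <-> c = false).
  by move=> kb kc; split=> [/(Eps_fun kb kc)|<-].
rewrite (propext (val _ _ gb ge)) (propext (val _ _ hb he')) (propext (val _ _ ghb gh)).
by case: e {ge gh}; case: e' {he'} => /=; split=> // -[]; auto.
Qed.

Lemma subgroup_inv G g g' : subgroup G -> G g ->
  (forall x, g (g' x) = x) -> (forall x, g' (g x) = x) -> G g'.
Proof.
move=> [_ [_ [_ Ginv]]] /Ginv[k [Gk [gk kg]]] gg' g'g.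
by apply: pred_eq1 Gk => x; rewrite -[k x]g'g gk.
Qed.

Lemma normal_of_parity G (C : (R -> R) -> Prop) : subgroup G ->
  (forall g h, G g -> G h -> (C (fun x => g (h x)) <-> (C g <-> C h))) ->
  normalPC (fun g => G g /\ C g) G.
Proof.
move=> sG Chom; have [GP [G1 [Gcomp Ginv]]] := sG.
(* For [id o id] the hypothesis reads [C id <-> (C id <-> C id)]. *)
have C1 : C id by apply/(Chom id id).
have CV g g' : G g -> G g' -> (forall x, g (g' x) = x) -> (C g <-> C g').
  by move=> Gg Gg' gg'; apply/Chom => //; apply: pred_eq1 C1 => x; rewrite gg'.
split; [split; [|split; [|split]] | split].
- by move=> h [/GP].
- by [].
- by move=> g h [Gg Cg] [Gh Ch]; split; [exact: Gcomp | apply/Chom].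
- move=> g [Gg Cg]; have [g' [Gg' [gg' g'g]]] := Ginv _ Gg.
  by exists g'; split=> //; split=> //; apply/(CV g).
- by move=> n [].
- move=> g g' n Gg gg' g'g [Gn Cn]; have Gg' := subgroup_inv sG Gg gg' g'g.
  have Gng : G (fun x => n (g' x)) by exact: Gcomp.
  split; first exact: (Gcomp _ _ Gg Gng).
  have := CV _ _ Gg Gg' gg'; have := Chom _ _ Gn Gg'; have := Chom _ _ Gg Gng; tauto.
Qed.

Lemma KerEps_normal G : subgroup G -> normalPC (KerEps G) G.
Proof.
move=> sG; have [GP _] := sG.
have -> : KerEps G = (fun h => G h /\ Eps h false).
  by apply: same_set_eq => h; split=> -[Gh ?]; split=> //; apply/eps_val_Eps => //; exact: GP.
by apply: normal_of_parity => // g h /GP ? /GP ?; exact: Eps_even_comp.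
Qed.

Lemma Sfin_normal G : subgroup G -> (forall s, Sfin s -> G s) -> normalPC Sfin G.
Proof.
move=> sG SG; have [GP _] := sG; split; [split; [|split; [|split]] | split] => //.
- by move=> h [].
- by apply: (Sfin_sws (ts := [::])).
- move=> g h /SfinP[ts [pts tX] gE] /SfinP[us [pus uX] hE].
  apply/SfinP; exists (ts ++ us); last by move=> x; rewrite sws_cat gE hE.
  split; first by rewrite /proper_swaps all_cat [all _ ts]pts.
  by move=> t; rewrite mem_cat => /orP[/tX|/uX].
- move=> g /SfinP[ts [pts tX] gE]; exists (sws (rev ts)); split.
    apply: Sfin_sws; split; first by rewrite /proper_swaps all_rev.
    by move=> t; rewrite mem_rev; exact: tX.
  have K us : cancel (sws (rev us)) (sws us).
    by elim: us => //= t us IH x; rewrite rev_cons -cats1 sws_cat /= IH swK.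
  by split=> x; rewrite gE ?K // -{2}(revK ts) K.
- move=> g g' n Gg gg' g'g /SfinP[ts [pts tX] nE]; have [gI _ gX] := PCB_bijX (GP _ Gg).
  apply/SfinP; exists [seq (g t.1, g t.2) | t <- ts].
    split; first by rewrite proper_swaps_map.
    by move=> _ /mapP[t /tX[? ?] ->] /=; rewrite !gX.
  by move=> x; rewrite nE (sws_morph _ _ gI) gg'.
Qed.

(** [Afin] is the intersection of the normal subgroups [Sfin] and [KerEps G]. *)
Lemma Afin_normal G : subgroup G -> (forall s, Sfin s -> G s) -> normalPC Afin G.
Proof.
move=> sG SG; have [GP _] := sG.
have -> : Afin = (fun h => Sfin h /\ KerEps G h).
  apply: same_set_eq => h; rewrite (propext (Afin_Eps h)).
  split=> [[Sh eh]|[Sh [Gh eh]]]; (split=> //; first last); last first.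
    by apply/eps_val_Eps => //; exact: GP.
  by split; [exact: SG | apply/eps_val_Eps => //; apply: GP; exact: SG].
have [[_ [S1 [Sc Sv]]] [_ Sn]] := Sfin_normal sG SG.
have [sK [_ Kn]] := KerEps_normal sG; have [KP [K1 [Kc Kv]]] := sK.
split; [split; [|split; [|split]] | split].
- by move=> h [_ /KP].
- by [].
- by move=> g h [? ?] [? ?]; split; [exact: Sc | exact: Kc].
- move=> g [Sg Kg]; have [g' [Sg' [gg' g'g]]] := Sv _ Sg; exists g'; split=> //; split=> //.
  exact: subgroup_inv sK Kg gg' g'g.
- by move=> n [/SG].
- by move=> g g' n Gg gg' g'g [? ?]; split; [exact: (Sn g g') | exact: (Kn g g')].
Qed.

Lemma triv_eq : triv = eq id.
Proof.
apply: same_set_eq => h; split=> [h1|<-//]; by apply/funext => x; rewrite h1.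
Qed.

Lemma triv_normal G : subgroup G -> normalPC triv G.
Proof.
move=> [GP [G1 _]]; rewrite triv_eq; split; [split; [|split; [|split]] | split].
- by move=> _ <-; exact: GP.
- by [].
- by move=> _ _ <- <-.
- by move=> _ <-; exists id.
- by move=> _ <-.
- by move=> g g' _ _ gg' _ <-; apply/funext => x; rewrite gg'.
Qed.

Lemma self_normal G : subgroup G -> normalPC G G.
Proof.
move=> sG; have [GP [G1 [Gc Gv]]] := sG; split=> //; split=> // g g' n Gg gg' g'g Gn.
have Gg' := subgroup_inv sG Gg gg' g'g.
exact: (Gc g (fun x => n (g' x)) Gg (Gc n g' Gn Gg')).
Qed.

Lemma normal_conj_sw G N a b n : (forall s, Sfin s -> G s) -> normalPC N G ->
  a <> b -> X a -> X b -> N n -> N (fun x => sw a b (n (sw a b x))).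
Proof.
move=> SG [_ [_ Nn]] ab Xa Xb Nnn.
by apply: Nn => // [|x|x]; [apply: SG; exact: Sfin_sw | exact: swK | exact: swK].
Qed.

(** * Three-cycles in a nontrivial normal subgroup *)

(** For distinct points the displayed map is the three-cycle [x -> y -> z -> x]. *)
Definition has_cycle (N : (R -> R) -> Prop) (x y z : R) : Prop :=
  N (fun u => sw x y (sw z y u)).

Definition three_points (x y z : R) : Prop :=
  [/\ X x, X y & X z] /\ [/\ x <> y, x <> z & y <> z].

Lemma has_cycle_conj G N a b x y z : (forall s, Sfin s -> G s) -> normalPC N G ->
  a <> b -> X a -> X b ->
  has_cycle N x y z -> has_cycle N (sw a b x) (sw a b y) (sw a b z).
Proof.
move=> SG NN ab Xa Xb /(normal_conj_sw SG NN ab Xa Xb); apply: pred_eq1 => u.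
by do 2 rewrite (sw_morph _ _ _ (@sw_inj _ a b)); rewrite swK.
Qed.

(** Conjugating by a transposition replaces one point of the cycle by a point off it. Passing
    through fresh [u], [v], [w] allows the two triples to overlap. *)
Lemma has_cycle_all G N x y z x' y' z' : (forall s, Sfin s -> G s) -> normalPC N G ->
  three_points x y z -> three_points x' y' z' -> has_cycle N x y z -> has_cycle N x' y' z'.
Proof.
move=> SG NN [[Xx Xy Xz] [xy xz yz]] [[Xx' Xy' Xz'] [xy' xz' yz']].
have [u Xu uL] := fresh [:: x; y; z; x'; y'; z'].
have [v Xv vL] := fresh [:: u; x; y; z; x'; y'; z'].
have [w Xw wL] := fresh [:: u; v; x; y; z; x'; y'; z'].
have [[? ? ?] ? ? ?] : [/\ [/\ u <> x, u <> y & u <> z], u <> x', u <> y' & u <> z'].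
  by split; [split| | |]; apply: uL; rewrite !inE eqxx ?orbT.
have [[? ? ? ? ?] ? ?] : [/\ [/\ v <> u, v <> x, v <> y, v <> z & v <> x'], v <> y' & v <> z'].
  by split; [split| |]; apply: vL; rewrite !inE eqxx ?orbT.
have [[? ? ? ? ?] ? ? ?] :
    [/\ [/\ w <> u, w <> x, w <> y, w <> z & w <> x'], w <> y', w <> z' & w <> v].
  by split; [split| | |]; apply: wL; rewrite !inE eqxx ?orbT.
have step1 p q r p' : p' <> p -> p <> q -> p <> r -> p' <> q -> p' <> r -> X p -> X p' ->
    has_cycle N p q r -> has_cycle N p' q r.
  move=> p'p pq pr p'q p'r Xp Xp' /(has_cycle_conj SG NN p'p Xp' Xp).
  by rewrite swR !swD //; apply: nesym.
have step2 p q r q' : q' <> q -> q <> p -> q <> r -> q' <> p -> q' <> r -> X q -> X q' ->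
    has_cycle N p q r -> has_cycle N p q' r.
  move=> q'q qp qr q'p q'r Xq Xq' /(has_cycle_conj SG NN q'q Xq' Xq).
  by rewrite swR !swD //; apply: nesym.
have step3 p q r r' : r' <> r -> r <> p -> r <> q -> r' <> p -> r' <> q -> X r -> X r' ->
    has_cycle N p q r -> has_cycle N p q r'.
  move=> r'r rp rq r'p r'q Xr Xr' /(has_cycle_conj SG NN r'r Xr' Xr).
  by rewrite swR !swD //; apply: nesym.
move=> /(step1 x y z u) H1.
have /(step2 u y z v) H2 : has_cycle N u y z by apply: H1; auto.
have /(step3 u v z w) H3 : has_cycle N u v z by apply: H2; auto.
have /(step1 u v w x') H4 : has_cycle N u v w by apply: H3; auto.
have /(step2 x' v w y') H5 : has_cycle N x' v w by apply: H4; auto.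
have /(step3 x' y' w z') H6 : has_cycle N x' y' w by apply: H5; auto.
by apply: H6; auto.
Qed.

(* With [z] fresh, [h] conjugates [(x y)] to [(h x, h y)], so [N] contains both
   [(h x, h y)(x y)] and its conjugate [(h x, h y)(z y)] by [(x z)]; their quotient is a
   three-cycle whether or not [h y = y]. *)
Lemma normal_has_cycle G N h : (forall s, Sfin s -> G s) -> normalPC N G -> subgroup G ->
  N h -> ~ triv h -> exists x y z, three_points x y z /\ has_cycle N x y z.
Proof.
move=> SG NN sG Nh nh; have [[NP [N1 [Nc Nv]]] [NG Nn]] := NN.
have [hI hS hX] := PCB_bijX (NP _ Nh).
have [x hx] : exists x, h x <> x.
  by apply: contrapT => H; apply: nh => x; apply: contrapT => hx; apply: H; exists x.
have Xx : X x by apply: contrapT => /(NP _ Nh).1.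
have [h' [Nh' [hh' h'h]]] := Nv _ Nh.
have [y Xy yL] := fresh [:: x; h x; h' x].
have [yx yhx yh'x] : [/\ y <> x, y <> h x & y <> h' x].
  by split; apply: yL; rewrite !inE eqxx ?orbT.
have [z Xz zL] := fresh [:: x; y; h x; h y].
have [zx zy zhx zhy] : [/\ z <> x, z <> y, z <> h x & z <> h y].
  by split; apply: zL; rewrite !inE eqxx ?orbT.
have hyx : h y <> x by move=> E; apply: yh'x; rewrite -E h'h.
have Xhx : X (h x) by apply/hX.
have Xhy : X (h y) by apply/hX.
have Gxy : Sfin (sw x y) by apply: Sfin_sw => //; exact: nesym.
have N1' : N (fun u => sw (h x) (h y) (sw x y u)).
  have Nc' : N (fun u => sw x y (h' (sw x y u))) by apply: Nn (SG _ Gxy) _ _ Nh' => u; exact: swK.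
  apply: pred_eq1 (Nc _ _ Nh Nc') => u.
  by rewrite (sw_morph _ _ _ hI) hh'.
have N2' : N (fun u => sw (h x) (h y) (sw z y u)).
  apply: pred_eq1 (normal_conj_sw SG NN (nesym zx) Xx Xz N1') => u.
  do 2 rewrite (sw_morph _ _ _ (@sw_inj _ x z)); rewrite swK swL.
  by rewrite (swD (x := h x)) ?(swD (x := h y)) ?(swD (x := y)) //; exact: nesym.
exists x, y, z; split; first by split; split=> //; exact: nesym.
have [n' [Nn' [_ n'n]]] := Nv _ N1'.
apply: pred_eq1 (Nc _ _ Nn' N2') => u.
by have := n'n (sw x y (sw z y u)); rewrite swK.
Qed.

(** All three-cycles lie in [N], hence all products of two transpositions, and an even product is
    cut into such pairs. *)
Lemma normal_Afin G N h : (forall s, Sfin s -> G s) -> normalPC N G -> subgroup G ->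
  N h -> ~ triv h -> forall s, Afin s -> N s.
Proof.
move=> SG NN sG Nh nh; have [[NP [N1 [Nc Nv]]] [NG Nn]] := NN.
have [x [y [z [xyz cxyz]]]] := normal_has_cycle SG NN sG Nh nh.
have cyc a b c : three_points a b c -> has_cycle N a b c.
  by move=> abc; exact: has_cycle_all SG NN xyz abc cxyz.
have pair a b c d : a <> b -> c <> d -> X a -> X b -> X c -> X d ->
    N (fun u => sw a b (sw c d u)).
  move=> ab cd Xa Xb Xc Xd.
  have [u Xu uL] := fresh [:: a; b; c; d].
  have [v Xv vL] := fresh [:: u; a; b; c; d].
  have [ua ub uc ud] : [/\ u <> a, u <> b, u <> c & u <> d].
    by split; apply: uL; rewrite !inE eqxx ?orbT.
  have [vu va vb vc vd] : [/\ v <> u, v <> a, v <> b, v <> c & v <> d].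
    by split; apply: vL; rewrite !inE eqxx ?orbT.
  have c1 : has_cycle N a b u by apply: cyc; split; split=> //; exact: nesym.
  have c2 : has_cycle N b u v by apply: cyc; split; split=> //; exact: nesym.
  have c3 : has_cycle N u v d by apply: cyc; split; split=> //; exact: nesym.
  have c4 : has_cycle N v d c by apply: cyc; split; split=> //; exact: nesym.
  (* The product telescopes: [c1 c2] is [(a b)(u v)] and [c3 c4] is [(u v)(c d)]. *)
  apply: pred_eq1 (Nc _ _ (Nc _ _ c1 c2) (Nc _ _ c3 c4)) => t.
  by rewrite !(swC b u) swK !(swC v u) swK !(swC v d) swK.
move=> s /AfinP[ts [[pts tX] ev] /funext->].
have [n] := ubnP (size ts); elim: n ts pts tX ev => // n IH [|[a b] [|[c d] ts]] //.
move=> /= /and3P[/eqP ab /eqP cd pts] tX; rewrite negbK => ev lt.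
have [Xa Xb] := tX (a, b) (mem_head _ _).
have [Xc Xd] := tX (c, d) (mem_behead (s := (a, b) :: (c, d) :: ts) (mem_head _ _)).
have Nts : N (sws ts).
  apply: IH => //; last exact: ltnW.
  by move=> t tin; apply: tX; rewrite !inE tin !orbT.
exact: (Nc _ _ (pair a b c d ab cd Xa Xb Xc Xd) Nts).
Qed.

(** * Commutators and normal subgroups of index two *)

(** The witness is the commutator [a^-1 b^-1 a b], in which each parity is counted twice. *)
Lemma commutator_parity G (C : (R -> R) -> Prop) a b : subgroup G ->
  (forall g h, G g -> G h -> (C (fun x => g (h x)) <-> (C g <-> C h))) ->
  G a -> G b -> exists s, [/\ G s, C s & forall x, a (b x) = b (a (s x))].
Proof.
move=> sG Chom Ga Gb; have [GP [G1 [Gc Gv]]] := sG.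
have [a' [Ga' [aa' a'a]]] := Gv _ Ga; have [b' [Gb' [bb' b'b]]] := Gv _ Gb.
have Gab := Gc _ _ Ga Gb; have Gab' := Gc _ _ Ga' Gb'; have Gs := Gc _ _ Gab' Gab.
exists (fun x => a' (b' (a (b x)))); split=> //; last by move=> x; rewrite aa' bb'.
have C1 : C id by apply/(Chom id id).
have Ca : C a <-> C a' by apply/Chom => //; apply: pred_eq1 C1 => x; rewrite aa'.
have Cb : C b <-> C b' by apply/Chom => //; apply: pred_eq1 C1 => x; rewrite bb'.
have := Chom _ _ Gab' Gab; have := Chom _ _ Ga Gb; have := Chom _ _ Ga' Gb'; tauto.
Qed.

(* [N] has index two in [G], and so does the kernel of [Eps]; if they differed, the set where
   the two characters agree would be a normal subgroup between [Sfin] and [G] with abelian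
   quotient, hence equal to [Sfin]. *)
Lemma normal_index2 G N : subgroup G -> (forall s, Sfin s -> G s) ->
  quotient_nonabelian_simple G -> normalPC N G ->
  (forall s, Sfin s -> (N s <-> Eps s false)) -> (exists2 n, N n & ~ Sfin n) ->
  N = KerEps G.
Proof.
move=> sG SG [[a [b [Ga [Gb nab]]]] simple] NN NS [n0 Nn0 Sn0].
have [GP [G1 [Gc Gv]]] := sG; have [sN [NG Nn]] := NN; have [NP [N1 [Nc Nv]]] := sN.
have [[_ [S1 [Sc Sv]]] [_ Sn]] := Sfin_normal sG SG.
(* The product [N Sfin] is normal, contains [Sfin], and differs from it because of [n0]; simplicity
   makes it all of [G]. *)
have NSG k : G k -> exists n s, [/\ N n, Sfin s & forall x, k x = n (s x)].
  pose M g := exists n s, [/\ N n, Sfin s & forall x, g x = n (s x)].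
  have NM : normalPC M G.
    have MG m : M m -> G m.
      move=> [n [s [Nn' Ss mE]]]; apply: (@pred_eq1 G (fun x => n (s x)) m) => //.
      exact: Gc (NG _ Nn') (SG _ Ss).
    split; [split; [|split; [|split]] | split] => //.
    - by move=> h /MG /GP.
    - by exists id, id.
    - move=> g1 g2 [n1 [s1 [Nn1 Ss1 g1E]]] [n2 [s2 [Nn2 Ss2 g2E]]].
      have [n2' [Nn2' [n22' n2'2]]] := Nv _ Nn2.
      (* [n1 s1 n2 s2 = (n1 n2) (n2^-1 s1 n2) s2], with the conjugate in [Sfin]. *)
      exists (fun x => n1 (n2 x)), (fun x => n2' (s1 (n2 (s2 x)))); split.
      + exact: Nc.
      + apply: (Sc (fun x => n2' (s1 (n2 x))) s2) => //.
        exact: Sn (NG _ Nn2') n2'2 n22' Ss1.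
      + by move=> x; rewrite n22' g1E g2E.
    - move=> g1 [n [s [Nn' Ss gE]]].
      have [n' [Nn'' [nn' n'n]]] := Nv _ Nn'; have [s' [Ss' [ss' s's]]] := Sv _ Ss.
      exists (fun x => s' (n' x)); split; last first.
        by split=> x; rewrite gE ?ss' ?nn' ?n'n ?s's.
      exists n', (fun x => n (s' (n' x))); split=> //; exact: Sn (NG _ Nn') nn' n'n Ss'.
    - move=> g g' m Gg gg' g'g [n [s [Nn' Ss mE]]].
      exists (fun x => g (n (g' x))), (fun x => g (s (g' x))); split.
      + exact: Nn Gg gg' g'g Nn'.
      + exact: Sn Gg gg' g'g Ss.
      + by move=> x; rewrite mE g'g.
  have SM s : Sfin s -> M s by move=> Ss; exists id, s.
  case: (simple M NM SM) => ME; last by move/ME.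
  by case: Sn0; apply/ME; exists n0, id.
have [X0 X1] : X 0 /\ X (1 / 2) by split; split; lra.
have ne : 0 <> 1 / 2 by lra.
pose tau := sw 0 (1 / 2); have tauK x : tau (tau x) = x by exact: swK.
have St : Sfin tau by exact: Sfin_sw.
have Et : ~ Eps tau false by move=> /(Eps_fun (Sfin_bijX St) (Eps_sw X0 X1 ne)).
have Ntau : ~ N tau by move/(NS _ St).
have Gt := SG _ St.
(* The odd transposition [tau] represents the only coset of [N] other than [N] itself, so [N] is the
   kernel of a character, as [Nhom] records. *)
have NC g : G g -> ~ N g -> N (fun x => g (tau x)).
  move=> /NSG[n [s [Nn' Ss gE]]] nNg.
  have nNs : ~ N s.
    by move=> Ns; apply: nNg; apply: pred_eq1 (Nc _ _ Nn' Ns) => x; rewrite gE.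
  have Nst : N (fun x => s (tau x)).
    apply/NS; first exact: Sc.
    apply/Eps_even_comp; [by case: Ss | by case: St | ].
    by split=> // /(NS _ Ss).
  by apply: pred_eq1 (Nc _ _ Nn' Nst) => x; rewrite gE.
have Nlr g h : N g -> G h -> (N (fun x => g (h x)) <-> N h).
  move=> Ng Gh; split=> [Ngh|]; last exact: Nc.
  have [g' [Ng' [_ g'g]]] := Nv _ Ng.
  by apply: pred_eq1 (Nc _ _ Ng' Ngh) => x; rewrite g'g.
have Nhom g h : G g -> G h -> (N (fun x => g (h x)) <-> (N g <-> N h)).
  move=> Gg Gh; case: (pselect (N g)) => Ng; first by have := Nlr _ _ Ng Gh; tauto.
  have NgT := NC _ Gg Ng.
  have -> : (fun x => g (h x)) = (fun x => g (tau (tau (h x)))).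
    by apply/funext => x; rewrite tauK.
  have E1 := Nlr _ (fun x => tau (h x)) NgT (Gc _ _ Gt Gh).
  have E2 : N h -> ~ N (fun x => tau (h x)).
    move=> Nh Nth; apply: Ntau; have [h' [Nh' [hh' _]]] := Nv _ Nh.
    by apply: pred_eq1 (Nc _ _ Nth Nh') => x; rewrite hh'.
  have E3 : ~ N h -> N (fun x => tau (h x)).
    move=> /(NC _ Gh) Nht; apply: pred_eq1 (Nn _ _ _ Gt tauK tauK Nht) => x.
    by rewrite tauK.
  by case: (pselect (N h)) => Nh; have := E2; have := E3; tauto.
have Ehom g h : G g -> G h ->
    (Eps (fun x => g (h x)) false <-> (Eps g false <-> Eps h false)).
  by move=> /GP pg /GP ph; exact: Eps_even_comp.
pose C g := N g <-> Eps g false.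
have Chom g h : G g -> G h -> (C (fun x => g (h x)) <-> (C g <-> C h)).
  move=> Gg Gh; rewrite /C (propext (Nhom _ _ Gg Gh)) (propext (Ehom _ _ Gg Gh)).
  by case: (pselect (N g)); case: (pselect (N h)); case: (pselect (Eps g false));
    case: (pselect (Eps h false)); tauto.
have [|K|K] := simple (fun g => G g /\ C g) (normal_of_parity sG Chom).
- by move=> s Ss; split; [exact: SG | exact: NS].
(* If the characters agreed only on [Sfin], the commutator of [a] and [b] would lie in [Sfin],
   against the choice of [a] and [b]. *)
- have [s [Gs Cs abs]] := commutator_parity sG Chom Ga Gb.
  by case: nab; exists s; split=> //; apply/K.
- apply: same_set_eq => g; split=> [Ng|[Gg eg]].
    have Gg := NG _ Ng; split=> //; apply/eps_val_Eps; first exact: GP.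
    by have [_ [+ _]] := (K g).2 Gg; apply.
  have [_ [_ H]] := (K g).2 Gg; apply: H; apply/eps_val_Eps => //; exact: GP.
Qed.

Theorem theorem1p3 (G : (R -> R) -> Prop) :
  subgroup G ->
  (forall s, Sfin s -> G s) ->
  quotient_nonabelian_simple G ->
  (forall N, normalPC N G <->
     (same_set N triv \/ same_set N Afin \/ same_set N Sfin \/
      same_set N (KerEps G) \/ same_set N G)) /\
  (~ same_set triv Afin /\ ~ same_set triv Sfin /\ ~ same_set triv (KerEps G) /\
   ~ same_set triv G /\ ~ same_set Afin Sfin /\ ~ same_set Afin (KerEps G) /\
   ~ same_set Afin G /\ ~ same_set Sfin (KerEps G) /\ ~ same_set Sfin G /\
   ~ same_set (KerEps G) G).
Proof.
move=> sG SG QG; have [GP [G1 [Gc Gv]]] := sG.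
have [X0 X1] : X 0 /\ X (1 / 2) by split; split; lra.
have X2 : X (1 / 3) by split; lra.
have ne : 0 <> 1 / 2 by lra.
pose tau := sw 0 (1 / 2).
have St : Sfin tau by exact: Sfin_sw.
have Gt := SG _ St.
have tau0 : ~ triv tau by move=> /(_ 0); rewrite /tau swL; lra.
have Et : ~ Eps tau false by move=> /(Eps_fun (Sfin_bijX St) (Eps_sw X0 X1 ne)).
have At : ~ Afin tau by move/Afin_Eps => [].
have Kt : ~ KerEps G tau by move=> [_ /(eps_val_Eps _ (GP _ Gt))].
(* Three elements separate the five subgroups: the three-cycle [cyc] is even and nontrivial, [tau]
   is odd, and the commutator in [comm] is even with infinite support. *)
pose cyc x := tau (sw 0 (1 / 3) x).
have cyc0 : ~ triv cyc by move=> /(_ 0); rewrite /cyc swL /tau swD; lra.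
have Ac : Afin cyc.
  apply/AfinP; exists [:: (0, 1 / 2); (0, 1 / 3)] => //; split=> //.
  by apply: swaps_in_X_cons => //; apply: swaps_in_X_cons => //; lra.
have AK s : Afin s -> KerEps G s.
  move=> /Afin_Eps[Ss es]; split; first exact: SG.
  by apply/eps_val_Eps => //; case: Ss.
have comm : exists2 k, KerEps G k & ~ Sfin k.
  have [[a [b [Ga [Gb nab]]]] _] := QG.
  have Ehom g h : G g -> G h ->
      (Eps (fun x => g (h x)) false <-> (Eps g false <-> Eps h false)).
    by move=> /GP pg /GP ph; exact: Eps_even_comp.
  have [s [Gs Es abs]] := commutator_parity (C := Eps^~ false) sG Ehom Ga Gb.
  exists s; first by split=> //; apply/eps_val_Eps => //; exact: GP.
  by move=> Ss; apply: nab; exists s.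
split; last first.
  have [k Kk Sk] := comm; have Gk : G k by case: Kk.
  do 9? split; move=> E.
  - by case: cyc0; apply/E.
  - by case: tau0; apply/E.
  - by case: cyc0; apply/E; exact: AK.
  - by case: tau0; apply/E.
  - by case: At; apply/E.
  - by case: Sk; have [] := (E k).2 Kk.
  - by case: At; apply/E.
  - by case: Kt; apply/E.
  - by case: Sk; apply/E.
  - by case: Kt; apply/E.
move=> N; split; last first.
  case=> [|[|[|[|]]]] /same_set_eq ->.
  - exact: triv_normal.
  - exact: Afin_normal.
  - exact: Sfin_normal.
  - exact: KerEps_normal.
  - exact: self_normal.
move=> NN; have [sN [NG Nn]] := NN; have [NP [N1 [Nc Nv]]] := sN.
case: (pselect (exists2 h, N h & ~ triv h)) => [[h Nh nh]|no]; last first.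
  left=> h; split=> [Nh|]; first by apply: contrapT => nh; apply: no; exists h.
  by move=> h1; apply: pred_eq1 N1 => x; rewrite h1.
right; have NA := normal_Afin SG NN sG Nh nh.
have odd_tau s : Sfin s -> ~ Eps s false -> Afin (fun x => s (tau x)).
  move=> Ss es; apply/Afin_Eps.
  have [[_ [_ [Sc _]]] _] := Sfin_normal sG SG; split; first exact: Sc.
  by apply/Eps_even_comp; [case: Ss | case: St | tauto].
have tauK x : tau (tau x) = x by exact: swK.
(* One odd element of [N] in [Sfin] yields [tau], hence all of [Sfin], and simplicity concludes.
   Otherwise [N] meets [Sfin] exactly in [Afin]. *)
case: (pselect (exists2 s, Sfin s /\ N s & ~ Eps s false)) => [[s [Ss Ns] es]|ev].
  have Nt : N tau.
    have [s' [Ns' [_ s's]]] := Nv _ Ns.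
    by apply: pred_eq1 (Nc _ _ Ns' (NA _ (odd_tau _ Ss es))) => x; rewrite s's.
  have SN r : Sfin r -> N r.
    move=> Sr; case: (pselect (Eps r false)) => er; first by apply/NA/Afin_Eps.
    by apply: pred_eq1 (Nc _ _ (NA _ (odd_tau _ Sr er)) Nt) => x; rewrite tauK.
  by have [_ simple] := QG; case: (simple N NN SN); tauto.
have NS s : Sfin s -> (N s <-> Eps s false).
  move=> Ss; split=> [Ns|es]; first by apply: contrapT => es; apply: ev; exists s.
  by apply/NA/Afin_Eps.
case: (pselect (exists2 n, N n & ~ Sfin n)) => [big|small].
  by do 2 right; left; rewrite (normal_index2 sG SG QG NN NS big).
left=> s; split=> [Ns|/NA//]; apply/Afin_Eps.
have Ss : Sfin s by apply: contrapT => Ss; apply: small; exists s.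
by split=> //; apply/NS.
Qed.
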